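(* There exists an absolute constant $C>0$ such that the following holds. Let $d,\ell\ge1$ be integers, let $\lambda\vdash_{d^2}\ell d$ be a partition of $\ell d$ into at most $d^2$ parts, let $\square:=(\ell,\ldots,\ell)$ be the rectangular partition of $\ell d$ into $d$ parts, and let $\epsilon>0$. Then there exist an integer $k\ge1$ and partitions $\Lambda\vdash_{d^2}k\ell d$ and $R_1,R_2\vdash_d k\ell d$ such that $g_{\Lambda,R_1,R_2}\ne0$ and $$\|\Lambda-k\lambda\|_1\le\epsilon|\Lambda|,\qquad \|R_i-k\square\|_1\le\epsilon|R_i|\quad\text{for } i=1,2.$$ Moreover, $k=O\big(\frac{d^4}{\epsilon^2}\log\frac d\epsilon\big)$, meaning that $k$ can be chosen with $k\le C\,\frac{d^4}{\epsilon^2}\log\frac{d}{\epsilon}$ whenever $\frac d\epsilon\ge2$.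
   Context: A partition $\lambda$ of $n$ is a monotonically decreasing sequence $(\lambda_1,\lambda_2,\ldots)$ of natural numbers, with only finitely many nonzero, whose sum is $|\lambda|=n$; $\lambda\vdash_d n$ means $\lambda$ is a partition of $n$ with at most $d$ nonzero parts. For an integer $k\ge1$, $k\lambda:=(k\lambda_1,k\lambda_2,\ldots)$. The norm is $\|x\|_1=\sum_i|x_i|$. Let $\mathscr{S}_\lambda$ be the complex irreducible representation of the symmetric group $\mathsf{S}_n$ labeled by $\lambda\vdash n$ (the Specht module). For partitions $\lambda,\mu,\nu$ of $n$, the Kronecker coefficient $g_{\lambda,\mu,\nu}$ is the dimension of the space of $\mathsf{S}_n$-invariants in $\mathscr{S}_\lambda\otimes\mathscr{S}_\mu\otimes\mathscr{S}_\nu$; equivalently, the multiplicity of $\mathscr{S}_\lambda$ in $\mathscr{S}_\mu\otimes\mathscr{S}_\nu$. *)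

(* Defs.v *)
From HB Require Import structures.
From mathcomp Require Import all_boot all_order all_algebra all_fingroup.
From mathcomp Require Import mxrepresentation character.
From mathcomp Require Import all_classical all_reals all_analysis.
From mathcomp Require Import complex.

Set Implicit Arguments.
Unset Strict Implicit.
Unset Printing Implicit Defensive.

Import Order.TTheory GRing.Theory Num.Theory.

Local Open Scope ring_scope.

(* A partition is given by the list of its nonzero parts; the infinite sequence
   of the usual definition is [nth 0 s], which is zero beyond the list. *)
Definition partition_of (d n : nat) (s : seq nat) : bool :=
  [&& sorted geq s, 0%N \notin s, (size s <= d)%N & sumn s == n].

Definition scale_part (k : nat) (s : seq nat) : seq nat := map (muln k) s.

Definition rect_part (d l : nat) : seq nat := nseq d l.

(* Both sequences vanish from index [maxn (size s) (size t)] on. *)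
Definition l1_dist (R : realType) (s t : seq nat) : R :=
  \sum_(i < maxn (size s) (size t)) `| (nth 0%N s i)%:R - (nth 0%N t i)%:R |.

Section Specht.

Variables (F : fieldType) (n : nat) (s : seq nat).

Local Notation G := [set: 'S_n]%G.
Local Notation aG := (regular_repr F G).

(* The tableau T of shape s (with sumn s = n) is filled row after row with
   0, ..., n-1, so that entry k lies in row [reshape_index s k] and in column
   [reshape_offset s k]. *)
Definition row_stab : {set 'S_n} :=
  [set p : 'S_n | [forall k, reshape_index s (p k) == reshape_index s k]].

Definition col_stab : {set 'S_n} :=
  [set q : 'S_n | [forall k, reshape_offset s (q k) == reshape_offset s k]].

(* Permutations act on the right, (p * q) k = q (p k), and so do the matrices
   of a representation (on row vectors). The tabloid {T}g is the right coset
   row_stab * g, i.e. the element \sum_(p in row_stab) p * g of the group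
   algebra, and the vector below is the polytabloid
   e_T = \sum_(q in col_stab) sgn(q) {T}q (the Young symmetrizer of T). *)
Definition polytabloid : 'rV[F]_(gcard G) :=
  gring_row (\sum_(p in row_stab) \sum_(q in col_stab)
               (-1) ^+ odd_perm q *: aG (p * q)%g).

(* The Specht module: the S_n-submodule generated by the polytabloid e_T. *)
Definition specht := submod_repr (cyclic_mx_module aG polytabloid).

End Specht.

(* Dimension of the S_n-invariants in the tensor product of the complex Specht
   modules labelled by three partitions of n. *)
Definition kronecker (R : realType) (n : nat) (s t u : seq nat) : nat :=
  \rank (rfix_mx (prod_repr (prod_repr (specht R[i] n s) (specht R[i] n t))
                            (specht R[i] n u)) [set: 'S_n]).

(* Main.v *)
(* Fix n = k l d and let V = C^d (x) C^d carry an orthonormal basis of maximally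
   entangled vectors (the d^2 clock-and-shift unitaries, seen as vectors). The
   words of a given content b over this basis span a permutation module W_b of
   S_n inside V^n = A^n (x) B^n, A = B = C^d.

   Young symmetrizers c_s detect every S_n-module, so W_b, A^n and B^n are sums of
   modules generated by the images of the c_s. An image of c_s has dimension at
   most poly(n) n^n / prod s_i^{s_i}, and c_s kills a word module unless some word
   of that content has distinct letters in each column of s. Weighting the words
   over the basis by p = lambda / (l d), the parts of the W_b belonging to shapes s
   with |s / n - p|_1 > eps have total weight at most
   poly(n) exp (- n KL(s / n, p)) <= poly(n) exp (- n eps^2 / 4), so for some b they
   make up less than half of W_b; with p uniform, the far part of A^n has dimension
   less than d^n / 4.

   Were all Kronecker coefficients of near triples zero, the trilinear pairing of
   W_b with A^n and B^n would vanish on the near parts. But an element of W_b is a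
   combination of orthogonal unitaries d^n x d^n, and the trace inequality
   [rank_annihilated_le] shows that the near part of W_b is too large for this. *)

Require Import Defs.
From HB Require Import structures.
From mathcomp Require Import all_boot all_order all_algebra all_fingroup.
From mathcomp Require Import pgroup cyclic separable cyclotomic sesquilinear spectral.
From mathcomp Require Import mxrepresentation character.
From mathcomp Require boolp.
From mathcomp Require Import reals sequences exp complex.
From mathcomp Require Import zify ring lra.

Set Implicit Arguments.
Unset Strict Implicit.
Unset Printing Implicit Defensive.

Import Order.TTheory GRing.Theory Num.Theory.

Local Open Scope ring_scope.
Local Open Scope sesquilinear_scope.

(** * Tableaux *)

Lemma leq_nth_sorted_ltn (u : seq nat) i :
  sorted ltn u -> (i < size u)%N -> (i <= nth 0%N u i)%N.
Proof.
move=> us; elim: i => // i IH iu.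
apply: leq_ltn_trans (IH (ltnW iu)) _.
by apply: (sorted_ltn_nth ltn_trans) => //; rewrite inE // ltnW.
Qed.

(** In increasing order, the [i]-th of distinct naturals is at least [i], and [p] decreases. *)
Lemma ler_prod_uniq (R : numDomainType) (p : nat -> R) (u : seq nat) :
  (forall i, 0 <= p i) -> {homo p : i j / (i <= j)%N >-> j <= i} -> uniq u ->
  \prod_(i <- u) p i <= \prod_(i < size u) p i.
Proof.
move=> p0 pd uu.
have sl : sorted ltn (sort leq u).
  by rewrite ltn_sorted_uniq_leq sort_uniq uu sort_sorted //; exact: leq_total.
rewrite (perm_big (sort leq u)) /=; last by rewrite perm_sym perm_sort.
rewrite (big_nth 0%N) big_mkord size_sort.
apply: ler_prod => i _; rewrite p0 pd //=.
by apply: leq_nth_sorted_ltn; rewrite ?size_sort.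
Qed.

(** Each [j] in [u] brings all of [0, ..., j] along, so [j < size u]; a duplicate-free list of that
    length inside the initial segment fills it. *)
Lemma perm_iota_downward (u : seq nat) :
  uniq u -> (forall i j, (i <= j)%N -> j \in u -> i \in u) ->
  perm_eq u (iota 0 (size u)).
Proof.
move=> uu ud; apply: uniq_perm (iota_uniq _ _) _ => //.
have sub : {subset u <= iota 0 (size u)}.
  move=> j ju; rewrite mem_iota /= add0n -[j.+1](size_iota 0).
  apply: uniq_leq_size (iota_uniq _ _) _ => i; rewrite mem_iota /= add0n ltnS.
  by move=> /ud; apply.
by have [] := uniq_min_size uu sub; rewrite ?size_iota.
Qed.

Section Tableau.

Variables (n : nat) (s : seq nat).
Hypotheses (s_sorted : sorted geq s) (s_sum : sumn s = n).

Local Notation row := (reshape_index s).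
Local Notation col := (reshape_offset s).

Lemma nth_part_homo i j : (i <= j)%N -> (nth 0%N s j <= nth 0%N s i)%N.
Proof.
move=> ij; have [js|js] := leqP (size s) j; first by rewrite nth_default.
have geqT : transitive geq by move=> x y z /= h1 h2; exact: leq_trans h2 h1.
have := sorted_leq_nth geqT leqnn 0%N s_sorted.
by apply; rewrite // inE // (leq_ltn_trans ij).
Qed.

Lemma row_lt (k : 'I_n) : (row k < size s)%N.
Proof. by apply: reshape_indexP; rewrite s_sum. Qed.

Lemma col_lt (k : 'I_n) : (col k < nth 0%N s (row k))%N.
Proof. by apply: reshape_offsetP; rewrite s_sum. Qed.

Lemma tableau_inj (i j : 'I_n) : row i = row j -> col i = col j -> i = j.
Proof.
move=> r c; apply: val_inj => /=.
by rewrite -(reshape_indexK s i) -(reshape_indexK s j) r c.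
Qed.

Lemma tableau_cell r c : (c < nth 0%N s r)%N ->
  exists k : 'I_n, row k = r /\ col k = c.
Proof.
move=> cr; have rs : (r < size s)%N.
  by rewrite ltnNge; apply/negP => h; rewrite nth_default in cr.
have kn : (flatten_index s r c < n)%N by rewrite -s_sum flatten_indexP.
by exists (Ordinal kn); rewrite /= flatten_indexKl ?flatten_indexKr.
Qed.

(** The column as an element of a finite type, so that products over cells can be split column by
    column. *)
Definition colo (k : 'I_n) : 'I_n :=
  Ordinal (leq_ltn_trans (leq_subr _ _) (ltn_ord k) : (col k < n)%N).

Definition col_rows c := [seq row k | k : 'I_n <- enum 'I_n & colo k == c].

(** The parts decrease, so above a cell of row [j] every earlier row has a cell in the same
    column. *)
Lemma perm_col_rows c : perm_eq (col_rows c) (iota 0 (size (col_rows c))).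
Proof.
apply: perm_iota_downward.
  rewrite map_inj_in_uniq => [|i j]; first exact: filter_uniq (enum_uniq _).
  rewrite !mem_filter => /andP[/eqP ci _] /andP[/eqP cj _] r.
  by apply: tableau_inj => //; case: ci cj => <- [].
move=> i j ij /mapP[k]; rewrite mem_filter => /andP[/eqP ck _] jk.
have [k' [rk' ck']] : exists k' : 'I_n, row k' = i /\ col k' = col k.
  apply: tableau_cell; apply: leq_trans (col_lt k) _; rewrite -jk.
  exact: nth_part_homo.
apply/mapP; exists k' => //; rewrite mem_filter mem_enum andbT.
by apply/eqP/val_inj; rewrite -ck.
Qed.

(* Column by column: the letters of a column are distinct, so their product is
   largest for the initial segment. *)
Lemma ler_prod_col_inj (R : numDomainType) (p : nat -> R) (f : 'I_n -> nat) :
  (forall i, 0 <= p i) -> {homo p : i j / (i <= j)%N >-> j <= i} ->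
  (forall i j : 'I_n, col i = col j -> f i = f j -> i = j) ->
  \prod_k p (f k) <= \prod_(k < n) p (row k).
Proof.
move=> p0 pd finj.
rewrite (partition_big colo xpredT) //= [leRHS](partition_big colo xpredT) //=.
apply: ler_prod => c _; apply/andP; split; first by apply: prodr_ge0.
set u := [seq f k | k <- enum 'I_n & colo k == c].
have -> : \prod_(k | colo k == c) p (f k) = \prod_(i <- u) p i.
  by rewrite big_map big_filter big_enum_cond.
have -> : \prod_(k | colo k == c) p (row k) = \prod_(i <- col_rows c) p i.
  by rewrite big_map big_filter big_enum_cond.
rewrite (perm_big _ (perm_col_rows c)) /=.
have -> : size (col_rows c) = size u by rewrite !size_map.
have := @big_mkord _ 1 *%R (size u) xpredT p; rewrite /index_iota subn0 => ->.
apply: ler_prod_uniq => //.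
rewrite map_inj_in_uniq => [|i j]; first exact: filter_uniq (enum_uniq _).
rewrite !mem_filter => /andP[/eqP ci _] /andP[/eqP cj _].
by apply: finj; case: ci cj => <- [].
Qed.

(* The letters in the first column are distinct. *)
Lemma size_col_inj m (f : 'I_n -> 'I_m) : 0%N \notin s ->
  (forall i j : 'I_n, col i = col j -> f i = f j -> i = j) -> (size s <= m)%N.
Proof.
move=> s0 finj.
have P0 (i : 'I_(size s)) : exists k : 'I_n, (row k == i) && (col k == 0%N).
  have [|k [rk ck]] := @tableau_cell i 0%N; last by exists k; rewrite rk ck !eqxx.
  by rewrite lt0n; apply: contraNneq s0 => <-; rewrite mem_nth.
pose g i := xchoose (P0 i).
have gP i : row (g i) = i /\ col (g i) = 0%N.
  by have /andP[/eqP-> /eqP->] := xchooseP (P0 i).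
have := @leq_card _ _ (f \o g); rewrite !card_ord; apply => i j /= fij.
have e : g i = g j by apply: finj; rewrite ?(gP i).2 ?(gP j).2.
by have := (gP i).1; rewrite e (gP j).1 => ij; exact: val_inj.
Qed.

Lemma ltn_row j (k : 'I_n) : (row k < j)%N = (k < sumn (take j s))%N.
Proof.
clear s_sorted.
have := reshape_indexK s k; rewrite /flatten_index => ek.
have := col_lt k; have := row_lt k.
set r := row k in ek *; set c := col k in ek * => rs cs.
have er : sumn (take r.+1 s) = (sumn (take r s) + nth 0 s r)%N.
  by rewrite (take_nth 0%N) // sumn_rcons.
have mono a b : (a <= b)%N -> (sumn (take a s) <= sumn (take b s))%N.
  by move=> ab; rewrite -(subnKC ab) takeD sumn_cat leq_addr.
have [/mono|/mono] := ltnP r j; last by lia.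
by lia.
Qed.

Lemma card_row_lt j : #|[set k : 'I_n | (row k < j)%N]| = sumn (take j s).
Proof.
clear s_sorted.
have le : (sumn (take j s) <= n)%N.
  by rewrite -s_sum -{2}(cat_take_drop j s) sumn_cat leq_addr.
rewrite -sum1_card (eq_bigl (fun k : 'I_n => (k < sumn (take j s))%N)).
  by rewrite (big_ord_narrow le) sum1_card card_ord.
by move=> k; rewrite inE ltn_row.
Qed.

End Tableau.

(** The weight equal to 2 on the first [j] rows and to 1 below gives 2 to the power of the [j]-th
    partial sum. All partial sums therefore agree, and without zero parts so do the lengths. *)
Lemma prod_row_inj n (s t : seq nat) :
  sumn s = n -> 0%N \notin s -> sumn t = n -> 0%N \notin t ->
  (forall p : nat -> rat, (forall i, 0 <= p i) ->
     {homo p : i j / (i <= j)%N >-> j <= i} ->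
     \prod_(k < n) p (reshape_index s k) = \prod_(k < n) p (reshape_index t k)) ->
  s = t.
Proof.
move=> ns s0 nt t0 h.
have ht j : sumn (take j s) = sumn (take j t).
  pose p i : rat := if (i < j)%N then 2 else 1.
  have pr (u : seq nat) : sumn u = n ->
      \prod_(k < n) p (reshape_index u k) = 2 ^+ sumn (take j u).
    move=> nu; rewrite -(card_row_lt nu) -prodr_const [RHS]big_mkcond /=.
    by apply: eq_bigr => k _; rewrite inE.
  have := h p; rewrite !pr // => hp.
  have : (2 : rat) ^+ sumn (take j s) = 2 ^+ sumn (take j t).
    apply: hp => [i|i k ik]; rewrite /p; first by case: ifP.
    by case: ltnP => h1; case: ltnP => h2 //; lia.
  rewrite -!natrX => /eqP; rewrite eqr_nat => /eqP.
  by move=> /(congr1 (logn 2)); rewrite !pfactorK.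
have hn j : nth 0%N s j = nth 0%N t j.
  have e (u : seq nat) : sumn (take j.+1 u) = (sumn (take j u) + nth 0 u j)%N.
    have [ju|ju] := ltnP j (size u); first by rewrite (take_nth 0%N) // sumn_rcons.
    by rewrite nth_default // !take_oversize ?addn0 // ltnW.
  by have := ht j.+1; rewrite !e ht => /addnI.
apply: (@eq_from_nth _ 0%N) => // ; apply/eqP; rewrite eqn_leq.
have lt (a b : seq nat) : 0%N \notin a -> (forall j, nth 0%N a j = nth 0%N b j) ->
    (size a <= size b)%N.
  move=> a0 ab; rewrite leqNgt; apply: contra a0 => l.
  by rewrite -(nth_default 0%N (leqnn (size b))) -ab mem_nth.
by rewrite !lt.
Qed.

(** * Cycle types *)

Lemma porbits_partition (T : finType) (p : {perm T}) :
  partition (porbits p) [set: T].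
Proof.
have -> : porbits p = [set orbit 'P <[p]>%g x | x in [set: T]].
  by apply/setP => X; apply/imsetP/imsetP => -[x _ ->];
    exists x; rewrite ?inE // porbitE.
by apply: orbit_partition; apply/actsP => q _ x; rewrite !inE.
Qed.

(** A normal form for conjugacy: with the cycles written as the rows of a tableau, longest first,
    [p] becomes the rotation of every row by one step, a permutation determined by [s] alone. *)
Lemma perm_cycle_type n (p : 'S_n) : exists (s : seq nat) (u : 'S_n),
  [/\ sorted geq s, 0%N \notin s, sumn s = n
    & forall k : 'I_n, ((u * p * u^-1)%g k : nat) =
        flatten_index s (reshape_index s k)
          ((reshape_offset s k).+1 %% nth 0%N s (reshape_index s k))].
Proof.
have partP := porbits_partition p.
have PX (X : {set 'I_n}) : exists l : seq 'I_n, X \in porbits p ->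
    exists2 x, X = porbit p x & l = traject p x #|porbit p x|.
  have [/imsetP[x _ ->]|_] := boolP (X \in porbits p); last by exists [::].
  by exists (traject p x #|porbit p x|) => _; exists x.
have [f fP] := boolp.choice PX.
pose ss := sort (fun a b => geq (size a) (size b)) [seq f X | X <- enum (porbits p)].
have pss : perm_eq ss [seq f X | X <- enum (porbits p)] by rewrite perm_sort.
have ssP l : l \in ss -> exists x, l = traject p x #|porbit p x|.
  rewrite (perm_mem pss) => /mapP[X]; rewrite mem_enum => /fP[x _ e ->].
  by exists x.
have ss_size : sumn (shape ss) = n.
  rewrite (perm_sumn (perm_map size pss)) -map_comp sumnE big_map big_enum /=.
  rewrite -[RHS](card_ord n) -cardsT (card_partition partP).
  apply: eq_bigr => X XP; have [x -> ->] := fP X XP.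
  by rewrite size_traject.
have ss_mem x : x \in flatten ss.
  apply/flattenP; exists (f (porbit p x)).
    by rewrite (perm_mem pss) map_f // mem_enum; apply: imset_f.
  have [|y e ->] := fP (porbit p x); first exact: imset_f.
  by rewrite -porbit_traject -e porbit_id.
have ss_sz : size (flatten ss) = n by rewrite size_flatten.
have ss_uniq : uniq (flatten ss).
  apply: (@leq_size_uniq _ (enum 'I_n)); rewrite ?enum_uniq //.
  by rewrite ss_sz size_enum_ord.
(* The relabelling sends [k] to the [k]-th entry of the concatenated cycles, which puts one cycle in
   each row. *)
have uinj : injective (fun k : 'I_n => nth k (flatten ss) k).
  move=> i j; rewrite [RHS](set_nth_default i) ?ss_sz // => /eqP.
  by rewrite nth_uniq ?ss_sz // => /eqP/val_inj.
exists (shape ss), (perm uinj); split=> //.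
- rewrite /shape sorted_map; apply: sort_sorted => a b /=.
  exact: leq_total.
- apply/mapP => -[l /ssP[x ->]]; rewrite size_traject => /esym.
  by move/eqP; rewrite cards_eq0 => /eqP e; have := porbit_id p x; rewrite e inE.
move=> k; set r := reshape_index _ _; set c := reshape_offset _ _.
have rs : (r < size ss)%N by rewrite -(size_map size); apply: row_lt.
have [x ex] := ssP _ (mem_nth [::] rs).
have er : nth 0%N (shape ss) r = #|porbit p x|.
  by rewrite (nth_map [::]) // ex size_traject.
have cr : (c < #|porbit p x|)%N by rewrite -er; apply: col_lt.
(* This handles the last cell of a row, whose successor is the first cell. *)
have iterM i : iter (i %% #|porbit p x|) p x = iter i p x.
  rewrite [in RHS](divn_eq i #|porbit p x|) addnC iterD; congr (iter _ _ _).
  by elim: (i %/ _)%N => [|q IH] //; rewrite mulSn iterD -IH iter_porbit.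
have x0 : (0 < #|porbit p x|)%N by apply: leq_ltn_trans cr.
rewrite er; set c' := (_ %% _)%N.
have c'r : (c' < nth 0%N (shape ss) r)%N by rewrite er ltn_pmod.
have k'n : (flatten_index (shape ss) r c' < n)%N.
  by rewrite -[X in (_ < X)%N]ss_size flatten_indexP.
rewrite -[flatten_index _ _ _]/(nat_of_ord (Ordinal k'n)); congr nat_of_ord.
rewrite !permM; apply: (@perm_inj _ (perm uinj)); rewrite permKV !permE.
rewrite (set_nth_default x) ?ss_sz // (set_nth_default x (Ordinal k'n)) ?ss_sz //.
rewrite !nth_flatten -/r -/c flatten_indexKl // flatten_indexKr //.
by rewrite !ex !nth_traject // ?iterM // ltn_pmod.
Qed.

(** * Young symmetrizers *)

Section GeneratedModule.

Variables (F : fieldType) (gT : finGroupType) (G : {group gT}) (m : nat).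
Variable rG : mx_representation F G m.

Definition gen_module k (A : 'M[F]_(k, m)) : 'M_m :=
  (\sum_(g in G) <<A *m rG g>>)%MS.

Lemma gen_module_id k (A : 'M_(k, m)) : (A <= gen_module A)%MS.
Proof.
by rewrite (sumsmx_sup 1%g) ?group1 // genmxE repr_mx1 mulmx1.
Qed.

Lemma gen_module_sub k l (A : 'M_(k, m)) (B : 'M_(l, m)) :
  (forall g, g \in G -> (A *m rG g <= B)%MS) -> (gen_module A <= B)%MS.
Proof. by move=> h; apply/sumsmx_subP => g Gg; rewrite genmxE h. Qed.

Lemma mem_gen_module k (A : 'M_(k, m)) g : g \in G ->
  (A *m rG g <= gen_module A)%MS.
Proof. by move=> Gg; rewrite (sumsmx_sup g) // genmxE. Qed.

Lemma gen_module_mod k (A : 'M_(k, m)) : mxmodule rG (gen_module A).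
Proof.
apply/mxmoduleP => h Gh; rewrite sumsmxMr; apply/sumsmx_subP => g Gg.
by rewrite (eqmxMr _ (genmxE _)) -mulmxA -repr_mxM // mem_gen_module // groupM.
Qed.

Lemma gen_module_mul0 k l (A : 'M_(k, m)) (B : 'M_(m, l)) :
  (forall g, g \in G -> A *m rG g *m B = 0) -> gen_module A *m B = 0.
Proof.
move=> h; apply/sub_kermxP; apply: gen_module_sub => g Gg.
by apply/sub_kermxP; exact: h.
Qed.

End GeneratedModule.

(** Otherwise [B] kills the submodule generated by [A], which is the whole space by
    irreducibility. *)
Lemma irr_mul_neq0 (F : fieldType) (gT : finGroupType) (G : {group gT}) m
    (rG : mx_representation F G m) (A B : 'M_m) :
  mx_irreducible rG -> A != 0 -> B != 0 ->
  exists2 g, g \in G & A *m rG g *m B != 0.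
Proof.
move=> /mx_irrP[_ irr] A0 B0.
have [/exists_inP[g Gg h]|/exists_inPn h] :=
  boolP [exists g in G, A *m rG g *m B != 0]; first by exists g.
have /irr : mxmodule rG (gen_module rG A) by exact: gen_module_mod.
have U0 : gen_module rG A != 0.
  apply: contraNneq A0 => e; have := gen_module_id rG A.
  by rewrite e submx0.
move=> /(_ U0) full; case/negP: B0; apply/eqP.
have : gen_module rG A *m B = 0.
  by apply: gen_module_mul0 => g /h; rewrite negbK => /eqP.
by move=> /(congr1 (mulmx (pinvmx (gen_module rG A)))); rewrite mulmxA mulVpmx // mul1mx mulmx0.
Qed.

Definition is_part (n : nat) (s : seq nat) : bool :=
  [&& sorted geq s, 0%N \notin s & sumn s == n].

Section YoungSymmetrizer.

Variables (F : fieldType) (n : nat).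
Local Notation G := [set: 'S_n]%G.

Definition row_sym s m (rG : mx_representation F G m) : 'M_m :=
  \sum_(p in row_stab n s) rG p.

Definition col_alt s m (rG : mx_representation F G m) : 'M_m :=
  \sum_(q in col_stab n s) (-1) ^+ odd_perm q *: rG q.

Definition young s m (rG : mx_representation F G m) : 'M_m :=
  row_sym s rG *m col_alt s rG.

Section OneRep.

Variables (m : nat) (rG : mx_representation F G m).

Lemma repr_perm_mul p q : rG (p * q)%g = rG p *m rG q.
Proof. by rewrite repr_mxM ?inE. Qed.

Lemma row_symM s p : p \in row_stab n s -> row_sym s rG *m rG p = row_sym s rG.
Proof.
rewrite inE => /forallP sp; rewrite /row_sym mulmx_suml.
rewrite [RHS](reindex_inj (mulIg p)) /=; apply: eq_big => [q|q _].
  by rewrite !inE; apply: eq_forallb => k; rewrite permM (eqP (sp _)).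
by rewrite repr_perm_mul.
Qed.

Lemma col_alt_tperm s (i j : 'I_n) : i != j ->
  reshape_offset s i = reshape_offset s j ->
  rG (tperm i j) *m col_alt s rG = - col_alt s rG.
Proof.
move=> ij cij; rewrite /col_alt mulmx_sumr.
rewrite [in RHS](reindex_inj (mulgI (tperm i j))) /= -sumrN.
have ct k : reshape_offset s (tperm i j k) = reshape_offset s k.
  by case: tpermP => [->|->|].
apply: eq_big => [q|q _].
  rewrite !inE; apply/forallP/forallP => sq k; last first.
    by have := sq (tperm i j k); rewrite permM tpermK ct.
  by rewrite permM (eqP (sq _)) ct.
rewrite repr_perm_mul -scalemxAr odd_permM odd_tperm ij /=.
by case: (odd_perm q); rewrite /= ?expr0 ?expr1 ?scaleN1r ?scale1r ?opprK.
Qed.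

(** The transposition fixes [A] but negates [col_alt], so the product equals its opposite and
    vanishes in characteristic 0. *)
Lemma col_alt_eq0 s k (A : 'M_(k, m)) (i j : 'I_n) : [pchar F] =i pred0 ->
  i != j -> reshape_offset s i = reshape_offset s j ->
  A *m rG (tperm i j) = A -> A *m col_alt s rG = 0.
Proof.
move=> F0 ij cij At; have : A *m col_alt s rG = - (A *m col_alt s rG).
  by rewrite -{1}At -mulmxA (col_alt_tperm ij) // mulmxN.
move/eqP; rewrite -subr_eq0 opprK -mulr2n -scaler_nat scaler_eq0.
by have := F0 2%N; rewrite !inE /= => ->; move/eqP.
Qed.

(** If [i] and [j] shared a column of [t] and, through [g], a row of [s], their transposition would
    be absorbed by [row_sym s] and negated by [col_alt t], and the product would vanish. *)
Lemma row_sym_col_alt_inj s t k (A : 'M_(k, m)) g : [pchar F] =i pred0 ->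
  A *m row_sym s rG *m rG g *m col_alt t rG != 0 ->
  forall i j : 'I_n, reshape_offset t i = reshape_offset t j ->
    reshape_index s ((g^-1)%g i) = reshape_index s ((g^-1)%g j) -> i = j.
Proof.
move=> F0 nz i j tij sij; apply/eqP; apply: contraNT nz => ij.
rewrite (col_alt_eq0 F0 ij) //.
have -> : A *m row_sym s rG *m rG g *m rG (tperm i j) =
    A *m (row_sym s rG *m rG (tperm (g^-1 i) (g^-1 j))%g) *m rG g.
  rewrite -!mulmxA -!repr_perm_mul; congr (_ *m (_ *m rG _)).
  by rewrite -tpermJ conjgE invgK !mulgA mulgKV.
rewrite row_symM // inE; apply/forallP => x.
by case: tpermP => [->|->|] //; rewrite sij.
Qed.

End OneRep.
End YoungSymmetrizer.

(** * Products of symmetrizers of different shapes *)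

Section Completeness.

Variables (F : fieldType) (n : nat).
Local Notation G := [set: 'S_n]%G.
Hypothesis F0 : [pchar F] =i pred0.

(** The middle factor [col_alt s], [g], [row_sym t] is a signed sum of group elements; some summand
    must survive. *)
Lemma young_ex m (rG : mx_representation F G m) s t g :
  young s rG *m rG g *m young t rG != 0 ->
  exists h, row_sym s rG *m rG h *m col_alt t rG != 0.
Proof.
have [/existsP[h ?] _|/existsPn h0] := boolP [exists h,
  row_sym s rG *m rG h *m col_alt t rG != 0]; first by exists h.
case/eqP; rewrite /young -!mulmxA (mulmxA (rG g)) (mulmxA (col_alt s rG)).
have -> : col_alt s rG *m (rG g *m row_sym t rG) =
    \sum_(q in col_stab n s) \sum_(p in row_stab n t)
       (-1) ^+ odd_perm q *: rG (q * (g * p))%g.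
  rewrite /col_alt mulmx_suml; apply: eq_bigr => q _.
  rewrite -scalemxAl /row_sym !mulmx_sumr scaler_sumr; apply: eq_bigr => p _.
  by rewrite !repr_perm_mul.
move: (row_sym s rG) (col_alt t rG) h0 => A B h0.
rewrite mulmx_suml mulmx_sumr big1 // => q _.
rewrite mulmx_suml mulmx_sumr big1 // => p _.
rewrite -scalemxAl -scalemxAr mulmxA.
by have := h0 (q * (g * p))%g; rewrite negbK => /eqP ->; rewrite scaler0.
Qed.

(** A multiplicative form of the dominance order. The rows of [s], transported by [h], are letters
    that are distinct in each column of [t], so [ler_prod_col_inj] applies. *)
Lemma young_prod_le m (rG : mx_representation F G m) s t g (p : nat -> rat) :
  is_part n s -> is_part n t -> young s rG *m rG g *m young t rG != 0 ->
  (forall i, 0 <= p i) -> {homo p : i j / (i <= j)%N >-> j <= i} ->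
  \prod_(k < n) p (reshape_index s k) <= \prod_(k < n) p (reshape_index t k).
Proof.
move=> /and3P[ss s0 /eqP ns] /and3P[ts t0 /eqP nt] /young_ex[h nz] p0 pd.
rewrite -[row_sym s rG]mul1mx in nz.
have inj := row_sym_col_alt_inj F0 nz.
have := ler_prod_col_inj ts nt p0 pd inj.
rewrite (reindex_inj (@perm_inj _ h)) /=.
by under eq_bigr do rewrite permK.
Qed.

Lemma young_inj m (rG : mx_representation F G m) s t g g' :
  is_part n s -> is_part n t ->
  young s rG *m rG g *m young t rG != 0 ->
  young t rG *m rG g' *m young s rG != 0 -> s = t.
Proof.
move=> sP tP h1 h2; have /and3P[_ s0 /eqP ns] := sP.
have /and3P[_ t0 /eqP nt] := tP; apply: (prod_row_inj ns) => // p p0 pd.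
by apply/eqP; rewrite eq_le (young_prod_le sP tP h1) // (young_prod_le tP sP h2).
Qed.

Lemma young_hom m1 m2 (r1 : mx_representation F G m1)
    (r2 : mx_representation F G m2) (f : 'M_(m1, m2)) s :
  (forall g, r1 g *m f = f *m r2 g) -> young s r1 *m f = f *m young s r2.
Proof.
move=> hf; rewrite /young.
have ha : row_sym s r1 *m f = f *m row_sym s r2.
  by rewrite mulmx_suml mulmx_sumr; apply: eq_bigr => p _.
have hb : col_alt s r1 *m f = f *m col_alt s r2.
  rewrite mulmx_suml mulmx_sumr; apply: eq_bigr => p _.
  by rewrite -scalemxAl -scalemxAr hf.
by rewrite -mulmxA hb !mulmxA ha.
Qed.

Lemma tableau_stab_trivial s (p q : 'S_n) : sumn s = n ->
  p \in row_stab n s -> q \in col_stab n s -> (p * q = 1)%g -> p = 1%g /\ q = 1%g.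
Proof.
rewrite !inE => ns /forallP hp /forallP hq e.
have ep : p = q^-1%g by apply: (mulIg q); rewrite e mulVg.
have q1 : q = 1%g.
  apply/permP => k; rewrite perm1; apply: (tableau_inj (s := s)).
    by have := hp (q k); rewrite ep permK => /eqP ->.
  exact/eqP/hq.
by rewrite ep q1 invg1.
Qed.

Lemma young_regularE s : young s (regular_repr F G) =
  \sum_(p in row_stab n s) \sum_(q in col_stab n s)
    (-1) ^+ odd_perm q *: regular_repr F G (p * q)%g.
Proof.
rewrite /young mulmx_suml; apply: eq_bigr => p _.
rewrite mulmx_sumr; apply: eq_bigr => q _.
by rewrite -scalemxAr repr_perm_mul.
Qed.

(** The coefficient of the identity is 1, since [p * q = 1] only when both factors are trivial. *)
Lemma young_regular_neq0 s : sumn s = n -> young s (regular_repr F G) != 0.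
Proof.
move=> ns; apply/eqP => /(congr1 (fun A => gring_proj (G := G) 1%g A 0 0)).
rewrite young_regularE !linear_sum summxE.
rewrite (bigD1 1%g) /=; last by rewrite inE; apply/forallP => k; rewrite perm1.
rewrite linear_sum summxE.
rewrite (bigD1 1%g) /=; last by rewrite inE; apply/forallP => k; rewrite perm1.
rewrite linearZ /= odd_perm1 expr0 scale1r mulg1 gring_projE ?inE // eqxx.
rewrite !big1 ?addr0.
- by rewrite linear0 !mxE => /eqP; rewrite oner_eq0.
- move=> p /andP[hp p1]; rewrite linear_sum summxE big1 // => q hq.
  rewrite linearZ /= gring_projE ?inE //; case: eqP => [e|]; last first.
    by rewrite !mxE mulr0.
  by have [e1 _] := tableau_stab_trivial ns hp hq (esym e); rewrite e1 eqxx in p1.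
- move=> q /andP[hq q1]; rewrite linearZ /= mul1g gring_projE ?inE //.
  by rewrite eq_sym (negbTE q1) !mxE mulr0.
Qed.

End Completeness.

(** * Symmetrizers detect every module *)

Section Complete.

Variables (F : closedFieldType) (n : nat).
Local Notation G := [set: 'S_n]%G.
Hypothesis F0 : [pchar F] =i pred0.

Lemma pchar0_group : (([pchar F]^').-group G)%g.
Proof.
rewrite /pgroup; apply/pnatP; first exact: cardG_gt0.
by move=> p _ _; rewrite inE /= -[_ \in _]/(p \in [pchar F]) F0.
Qed.

(** The symmetrizer is a nonzero element of the group algebra. It splits along the Wedderburn
    components, and each irreducible representation is injective on its own component, so they
    cannot all kill it. *)
Lemma young_irr_neq0 (sG : irrType F G) s : sumn s = n ->
  exists i : sG, young s (irr_repr i) != 0.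
Proof.
move=> ns; have [/existsP//|/existsPn h] :=
  boolP [exists i : sG, young s (irr_repr i) != 0].
case/negP: (young_regular_neq0 F ns); apply/eqP.
set A := young s _.
have memA : (A \in enveloping_algebra_mx (regular_repr F G))%MS.
  rewrite /A young_regularE linear_sum summx_sub // => p _.
  rewrite linear_sum summx_sub // => q _; rewrite linearZ scalemx_sub //.
  by apply: envelop_mx_id; rewrite inE.
have opA (i : sG) : gring_op (irr_repr i) A = 0.
  transitivity (young s (irr_repr i)); last by have := h i; rewrite negbK => /eqP.
  rewrite /A young_regularE linear_sum /young mulmx_suml; apply: eq_bigr => p _.
  rewrite linear_sum mulmx_sumr; apply: eq_bigr => q _.
  by rewrite linearZ /= gring_opG ?inE // -scalemxAr repr_perm_mul.
have F'G := pchar0_group.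
rewrite -[A]mulmx1 -(Wedderburn_sum_id_pchar sG F'G) mulmx_sumr big1 // => i _.
have Ri := Wedderburn_id_mem i.
apply: (@regular_op_inj_pchar _ _ _ sG F'G _ (irr_repr i) (socle_irr i)).
- rewrite inE irr_reprK_pchar //.
  have /andP[ideal _] := Wedderburn_ideal i.
  by apply: (memmx_subP ideal); rewrite mem_mulsmx.
- by rewrite inE linear0 sub0mx //.
rewrite gring_opM ?opA ?mul0mx ?linear0 //.
rewrite -(Wedderburn_sum_pchar sG F'G).
exact: submx_trans Ri (sumsmx_sup i _ (submx_refl _)).
Qed.

(* Sending a partition to an irreducible on which its symmetrizer survives is
   injective by [young_inj]; there are as many irreducibles as conjugacy classes,
   hence at most as many as cycle types, so the map is onto. *)
Lemma irr_young (sG : irrType F G) (j : sG) :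
  exists2 s, is_part n s & young s (irr_repr j) != 0.
Proof.
have F'G := pchar0_group.
apply: boolp.contrapT => hj.
have hK (K : {set 'S_n}) : exists si : seq nat * sG, K \in classes G ->
   [/\ is_part n si.1, young si.1 (irr_repr si.2) != 0 &
     exists2 u : 'S_n, (u \in K) & forall k : 'I_n, (u k : nat) =
        flatten_index si.1 (reshape_index si.1 k)
          ((reshape_offset si.1 k).+1 %% nth 0%N si.1 (reshape_index si.1 k))].
  have [/imsetP[p _ ->]|_] := boolP (K \in classes G); last by exists ([::], j).
  have [s [u [ss s0 ns hu]]] := perm_cycle_type p.
  have [i hi] := young_irr_neq0 sG ns.
  exists (s, i) => _; split=> //=; first by rewrite /is_part ss s0 ns eqxx.
  exists (u * p * u^-1)%g; last by [].
  apply/imsetP; exists u^-1%g; rewrite ?inE //.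
  by rewrite conjgE invgK mulgA.
have [f fP] := boolp.choice hK.
have finj : {in classes G &, injective (fun K => (f K).2)}.
  move=> K L KG LG /= e; have [sK yK [u uK hu]] := fP K KG.
  have [sL yL [v vL hv]] := fP L LG.
  have irr := socle_irr (f K).2.
  rewrite -e in yL.
  have [g _ h1] := irr_mul_neq0 irr yK yL.
  have [g' _ h2] := irr_mul_neq0 irr yL yK.
  have es := young_inj F0 sK sL h1 h2.
  (* The normal form depends on the shape only, so the two classes share an element. *)
  have euv : u = v by apply/permP => k; apply: val_inj; rewrite /= hu hv es.
  move: KG uK LG vL => /imsetP[x _ ->] ux /imsetP[y _ ->] vy.
  by rewrite -(class_eqP ux) -(class_eqP vy) euv.
have : (#|[set (f K).2 | K in classes G]| <= #|[set~ j]|)%N.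
  apply/subset_leq_card/subsetP => i /imsetP[K /fP[sK yK _] ->].
  by rewrite !inE; apply/eqP => e; apply: hj; exists (f K).1; rewrite -?e.
rewrite (card_in_imset finj) cardsC1 (card_irr_pchar sG F'G); last first.
  exact: group_closure_closed_field.
have : (0 < #|classes G|)%N.
  by rewrite card_gt0; apply/set0Pn; exists (1%g ^: G)%g; apply: mem_classes; rewrite inE.
by case: #|_| => // c _; rewrite ltnn.
Qed.

(** A nonzero [U] contains a simple submodule; this is isomorphic to an irreducible on which some
    symmetrizer acts nontrivially by [irr_young]. *)
Lemma young_complete m (rG : mx_representation F G m) k (U : 'M_(k, m)) :
  mxmodule rG U -> (forall s, is_part n s -> U *m young s rG = 0) -> U = 0.
Proof.
move=> modU hU; apply/eqP; apply: contraT => nzU.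
have F'G := pchar0_group.
apply: (mxsimple_exists modU nzU) => -[V simV VU].
apply: (socle_exists (regular_repr F G)) => sG.
have [modV _ _] := simV.
have irrV : mx_irreducible (submod_repr modV) by apply/submod_mx_irr.
have rsimV := rsim_irr_comp_pchar sG F'G irrV.
set j := irr_comp _ _ in rsimV.
have [s sP nz] := irr_young j.
case/negP: nz; apply/eqP.
have [f _ ffree fhom] := mx_rsim_sym rsimV.
have yV : young s (submod_repr modV) = 0.
  apply: (@val_submod_inj _ _ V); rewrite linear0.
  have hv g : submod_repr modV g *m val_submod 1%:M = val_submod 1%:M *m rG g.
    by rewrite -val_submodJ ?inE // mul1mx -val_submodE.
  rewrite val_submodE (young_hom _ hv).
  have /submxP[D ->] : (val_submod (U := V) 1%:M <= U)%MS.
    exact: submx_trans (val_submodP _) VU.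
  by rewrite -mulmxA hU // mulmx0.
apply: (row_free_inj ffree); rewrite mul0mx (young_hom (r2 := submod_repr modV)).
  by rewrite yV mulmx0.
by move=> g; apply: fhom; rewrite inE.
Qed.

End Complete.

(** * Word modules *)

Lemma mxrank_fiber (F : fieldType) q r (A : 'M[F]_(q, r)) (K : finType)
    (h : 'I_q -> K) :
  (forall i j, h i = h j -> row i A = row j A) -> (\rank A <= #|K|)%N.
Proof.
move=> hA; pose B := \matrix_(k < #|K|)
  (if [pick i | h i == enum_val k] is Some i then row i A else 0).
apply: leq_trans (rank_leq_row B); apply: mxrankS.
apply/row_subP => i; apply: (eq_row_sub (enum_rank (h i))).
rewrite rowK enum_rankK; case: pickP => [j /eqP /hA -> //|].
by move=> /(_ i); rewrite eqxx.
Qed.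

Lemma mxrank_sums_leq (F : fieldType) (I : finType) (P : pred I) q r
    (A : I -> 'M[F]_(q, r)) :
  (\rank (\sum_(i | P i) <<A i>>)%MS <= \sum_(i | P i) \rank (A i))%N.
Proof.
elim/big_ind2 : _ => [|a A' b B' h1 h2|i _]; first by rewrite mxrank0.
- by apply: leq_trans (mxrank_adds_leqif _ _) (leq_add h1 h2).
- by rewrite genmxE.
Qed.

Lemma row_symMl (F : fieldType) n s m
    (rG : mx_representation F [set: 'S_n]%G m) (p : 'S_n) :
  p \in row_stab n s -> rG p *m row_sym s rG = row_sym s rG.
Proof.
rewrite inE => /forallP sp; rewrite /row_sym mulmx_sumr.
rewrite [RHS](reindex_inj (mulgI p)) /=; apply: eq_big => [q|q _].
  rewrite !inE; apply/forallP/forallP => h k; last first.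
    have := sp ((p^-1)%g k); rewrite permKV => /eqP e.
    by have := h ((p^-1)%g k); rewrite permM permKV -e.
  by rewrite permM (eqP (h _)) sp.
by rewrite repr_perm_mul.
Qed.

Section WordAction.

Variables (n : nat) (T : Type).

(** The inverse makes this a right action, in line with [(p * q) k = q (p k)]. *)
Definition wact (f : {ffun 'I_n -> T}) (g : 'S_n) : {ffun 'I_n -> T} :=
  [ffun k => f ((g^-1)%g k)].

Lemma wactM f p q : wact (wact f p) q = wact f (p * q)%g.
Proof. by apply/ffunP => k; rewrite !ffunE invMg permM. Qed.

Lemma wact1 f : wact f 1 = f.
Proof. by apply/ffunP => k; rewrite ffunE invg1 perm1. Qed.

Lemma prod_wact (R : comNzRingType) (p : T -> R) f g :
  \prod_k p (wact f g k) = \prod_k p (f k).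
Proof.
rewrite (reindex_inj (@perm_inj _ g)); apply: eq_bigr => k _.
by rewrite ffunE permK.
Qed.

End WordAction.

Section Words.

Variables (F : fieldType) (n m : nat).
Local Notation G := [set: 'S_n]%G.
Local Notation word := {ffun 'I_n -> 'I_m}.

Definition word_delta (f : word) : 'rV[F]_#|{: word}| := delta_mx 0 (enum_rank f).

Definition word_mx (g : 'S_n) : 'M[F]_#|{: word}| :=
  \matrix_i word_delta (wact (enum_val i) g).

Lemma word_deltaM f g : word_delta f *m word_mx g = word_delta (wact f g).
Proof. by rewrite -rowE rowK enum_rankK. Qed.

Lemma word_mx_repr : mx_repr G word_mx.
Proof.
split=> [|p q _ _].
  apply/row_matrixP => i; rewrite rowK wact1 /word_delta enum_valK.
  by rewrite row1.
apply/row_matrixP => i; rewrite row_mul [RHS]/= !rowK word_deltaM wactM.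
by [].
Qed.

Canonical word_repr := MxRepresentation word_mx_repr.

Lemma word_matrixP (q : nat) (A B : 'M[F]_(#|{: word}|, q)) :
  (forall f, word_delta f *m A = word_delta f *m B) -> A = B.
Proof.
move=> h; apply/row_matrixP => i; have := h (enum_val i).
by rewrite /word_delta enum_valK -!rowE.
Qed.

Definition content (f : word) : {ffun 'I_m -> 'I_n.+1} :=
  [ffun i => inord #|[set k | f k == i]|].

Lemma content_wact f g : content (wact f g) = content f.
Proof.
apply/ffunP => i; rewrite !ffunE; congr inord.
rewrite -[RHS](card_imset _ (@perm_inj _ g)); apply: eq_card => k.
rewrite !inE ffunE; apply/idP/imsetP => [h|[x hx ->]].
  by exists ((g^-1)%g k); rewrite ?inE // permKV.
by rewrite permK; rewrite inE in hx.
Qed.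

(** Its row space is the permutation module [W_b] of the words of content [b]. *)
Definition content_proj (b : {ffun 'I_m -> 'I_n.+1}) : 'M[F]_#|{: word}| :=
  diag_mx (\row_i (content (enum_val i) == b)%:R).

Lemma content_projE f b :
  word_delta f *m content_proj b = (content f == b)%:R *: word_delta f.
Proof.
rewrite -rowE row_diag_mx mxE enum_rankK.
by case: eqP => _; rewrite ?scale1r ?scale0r.
Qed.

Lemma content_projC b g :
  content_proj b *m word_mx g = word_mx g *m content_proj b.
Proof.
apply: word_matrixP => f; rewrite !mulmxA content_projE word_deltaM.
by rewrite content_projE content_wact -scalemxAl word_deltaM.
Qed.

Lemma sum_content_proj : \sum_b content_proj b = 1%:M.
Proof.
apply: word_matrixP => f; rewrite mulmx_sumr mulmx1.
rewrite (bigD1 (content f)) //= content_projE eqxx scale1r big1 ?addr0 //.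
by move=> b /negbTE nb; rewrite content_projE eq_sym nb scale0r.
Qed.

Lemma rank_content_proj b : \rank (content_proj b) = #|[set f | content f == b]|.
Proof.
apply/eqP; rewrite eqn_leq; apply/andP; split.
  pose A := \matrix_(i < #|[set f | content f == b]|) word_delta (enum_val i).
  apply: leq_trans (rank_leq_row A); apply: mxrankS; apply/row_subP => i.
  have := content_projE (enum_val i) b.
  rewrite {1}/word_delta enum_valK -rowE => ->.
  have [e|_] := eqVneq; last by rewrite scale0r sub0mx.
  have iA : enum_val i \in [set f | content f == b] by rewrite inE e.
  rewrite scale1r; apply: (eq_row_sub (enum_rank_in iA (enum_val i))).
  by rewrite rowK enum_rankK_in.
pose A := \matrix_(i < #|[set f | content f == b]|) word_delta (enum_val i).
have AA : A *m A^T = 1%:M.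
  apply/matrixP => i j; rewrite !mxE (bigD1 (enum_rank (enum_val i))) //=.
  rewrite big1 ?addr0 => [|k /negbTE nk]; last by rewrite !mxE nk mul0r.
  by rewrite !mxE !eqxx /= mul1r (inj_eq enum_rank_inj) (inj_eq enum_val_inj).
have /eqnP <- : row_free A by apply/row_freeP; exists A^T.
apply: mxrankS; apply/row_subP => i; rewrite rowK.
have := enum_valP i; rewrite inE => e.
have -> : word_delta (enum_val i) = word_delta (enum_val i) *m content_proj b.
  by rewrite content_projE e scale1r.
exact: submxMl.
Qed.

(** Some word of content [b] survives [young s], hence one of its rearrangements survives
    [col_alt s]; a repeated letter in a column would make that image vanish. *)
Lemma word_young_neq0 b s : [pchar F] =i pred0 ->
  content_proj b *m young s word_repr != 0 ->
  exists2 f : word, content f = b &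
    forall i j : 'I_n, reshape_offset s i = reshape_offset s j -> f i = f j -> i = j.
Proof.
move=> F0 nz.
have [f fb nzf] : exists2 f, content f = b & word_delta f *m young s word_repr != 0.
  have [/existsP[f /andP[/eqP fb nzf]]|/existsPn h] := boolP [exists f,
      (content f == b) && (word_delta f *m young s word_repr != 0)].
    by exists f.
  case/eqP: nz; apply: word_matrixP => f.
  rewrite mulmxA content_projE mulmx0; have := h f.
  case: eqP => _ /=; rewrite ?scale0r ?mul0mx // scale1r negbK.
  by move/eqP.
have [p nzp] : exists p, word_delta (wact f p) *m col_alt s word_repr != 0.
  have [/existsP[p ?]|/existsPn h] := boolP [exists p,
    word_delta (wact f p) *m col_alt s word_repr != 0]; first by exists p.
  case/eqP: nzf; rewrite /young mulmxA; move: (col_alt s _) h => B h.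
  rewrite /row_sym mulmx_sumr mulmx_suml big1 // => p _; rewrite /= word_deltaM.
  by have := h p; rewrite negbK => /eqP.
exists (wact f p); first by rewrite content_wact.
move=> i j cij fij; apply/eqP; apply: contraNT nzp => ij.
rewrite (col_alt_eq0 F0 ij cij) // /= word_deltaM; congr word_delta.
by apply/ffunP => k; rewrite [LHS]ffunE tpermV; case: tpermP => [->|->|].
Qed.

End Words.

Lemma prod_content (R : comNzRingType) n m (p : 'I_m -> R) (f : {ffun 'I_n -> 'I_m}) :
  \prod_k p (f k) = \prod_i p i ^+ content f i.
Proof.
rewrite (partition_big f xpredT) //=; apply: eq_bigr => i _.
rewrite (eq_bigr (fun=> p i)) => [|k /eqP -> //]; rewrite prodr_const ffunE.
rewrite inordK; last first.
  by rewrite ltnS -[X in (_ <= X)%N](card_ord n) max_card.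
by congr (_ ^+ _); apply: eq_card => k; rewrite !inE.
Qed.

(** The surviving word has distinct letters in each column: the first column bounds the number of
    rows, and the column bound compares the weights. *)
Lemma word_young_weight (F : fieldType) (R : numDomainType) n m (p : nat -> R)
    (b : {ffun 'I_m -> 'I_n.+1}) s :
  [pchar F] =i pred0 -> is_part n s ->
  content_proj F b *m young s (word_repr F n m) != 0 ->
  (forall i, 0 <= p i) -> {homo p : i j / (i <= j)%N >-> j <= i} ->
  (size s <= m)%N /\
  \prod_(i < m) p i ^+ b i <= \prod_(k < n) p (reshape_index s k).
Proof.
move=> F0 /and3P[ss s0 /eqP ns] nz p0 pd.
have [f fb finj] := word_young_neq0 F0 nz.
split; first exact: size_col_inj finj.
rewrite -fb -(prod_content (p \o val)) /=.
apply: (ler_prod_col_inj ss ns (f := val \o f)) => // i j cij fij.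
by apply: finj => //; apply: val_inj.
Qed.

Lemma perm_of_fibers n (K : finType) (f g : 'I_n -> K) :
  (forall x, #|[set k | f k == x]| = #|[set k | g k == x]|) ->
  exists p : 'S_n, forall k, f k = g (p k).
Proof.
move=> h; pose t (f : 'I_n -> K) := [tuple f k | k < n].
have : perm_eq (t f) (t g).
  apply/allP => x _; apply/eqP; rewrite /t /= !count_map.
  have e (u : 'I_n -> K) : count (preim id (preim u (pred1 x))) (Finite.enum 'I_n) =
      #|[set k | u k == x]|.
    by rewrite -enumT -sum1_count big_enum_cond -sum1_card; apply: eq_bigl => k; rewrite !inE.
  by rewrite !e.
case/tuple_permP => p e; exists p => k.
have := congr1 (fun u => nth (f k) u k) e.
by rewrite /t -!tnth_nth ?tnth_mktuple.
Qed.

Section RowWords.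

Variables (F : fieldType) (n m : nat) (s : seq nat).
Hypotheses (ns : sumn s = n) (sm : (size s <= m)%N).
Local Notation word := {ffun 'I_n -> 'I_m}.

Definition row_ord (k : 'I_n) : 'I_m := Ordinal (leq_trans (row_lt ns k) sm).

(* The words with the same content as [row_ord]. *)
Definition row_words : {set word} := [set wact [ffun k => row_ord k] h | h : 'S_n].

(** The weights of all words add up to the [n]-th power of the sum of [q], which is 1, and every
    word in [row_words] has the same weight. *)
Lemma card_row_words (R : numDomainType) (q : nat -> R) :
  (forall i, 0 <= q i) -> \sum_(i < m) q i = 1 ->
  #|row_words|%:R * \prod_(k < n) q (reshape_index s k) <= 1.
Proof.
move=> q0 q1.
have e1 : \sum_(f : word) \prod_k q (f k) = 1.
  rewrite -(bigA_distr_bigA (fun k (i : 'I_m) => q i)) /=.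
  by rewrite big1 // => k _.
rewrite -[leRHS]e1 (bigID (mem row_words)) /=.
have -> : \sum_(f in row_words) \prod_k q (f k) =
    \sum_(f in row_words) \prod_(k < n) q (reshape_index s k).
  apply: eq_bigr => f /imsetP[h _ ->].
  rewrite (prod_wact (fun i : 'I_m => q i)).
  by apply: eq_bigr => k _; rewrite ffunE.
rewrite sumr_const mulr_natl lerDl.
by apply: sumr_ge0 => f _; apply: prodr_ge0.
Qed.

(** The row indexed by a word depends only on the orbit of that word under [row_stab], hence on the
    number of occurrences of each pair of a tableau row and a letter. There are [m * m] pairs and
    [n.+1] possible counts for each. *)
Lemma rank_row_sym :
  (\rank (row_sym s (word_repr F n m)) <= n.+1 ^ (m * m))%N.
Proof.
pose K := {ffun 'I_m * 'I_m -> 'I_n.+1}.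
pose fib (f : word) x := [set k | (row_ord k, f k) == x].
pose h (i : 'I_#|{: word}|) : K := [ffun x => inord #|fib (enum_val i) x|].
have -> : (n.+1 ^ (m * m))%N = #|K| by rewrite card_ffun card_prod !card_ord.
apply: (mxrank_fiber (h := h)) => i j hij.
have [|p hp] := @perm_of_fibers n _ (fun k => (row_ord k, (enum_val i : word) k))
    (fun k => (row_ord k, (enum_val j : word) k)).
  move=> x; have := congr1 val (congr1 (fun u : K => u x) hij).
  have le f : (#|fib f x| < n.+1)%N.
    by rewrite ltnS -[X in (_ <= X)%N](card_ord n) max_card.
  by rewrite !ffunE /= !inordK.
have ps : p \in row_stab n s.
  rewrite inE; apply/forallP => k.
  by have /= <- := congr1 (fun x => nat_of_ord x.1) (hp k).
have rowD i0 : row i0 (row_sym s (word_repr F n m)) =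
    word_delta F (enum_val i0) *m row_sym s (word_repr F n m).
  by rewrite rowE /word_delta enum_valK.
rewrite !rowD -{1}(row_symMl (word_repr F n m) ps) mulmxA /= word_deltaM.
congr (word_delta F _ *m _); apply/ffunP => k; rewrite ffunE.
by have /= -> := congr1 snd (hp ((p^-1)%g k)); rewrite permKV.
Qed.

End RowWords.

(** Translates of [E *m row_sym s rG] depend only on the coset of [row_stab], and the cosets
    correspond to the words in [row_words]. Each translate has rank at most that of [row_sym]. *)
Lemma rank_gen_young (F : fieldType) n m s (ns : sumn s = n)
    (sm : (size s <= m)%N) q (rG : mx_representation F [set: 'S_n]%G q)
    k (E : 'M_(k, q)) :
  (\rank (gen_module rG (E *m young s rG)) <=
     #|row_words ns sm| * \rank (row_sym s rG))%N.
Proof.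
pose rw : {ffun 'I_n -> 'I_m} := [ffun k => row_ord ns sm k].
(* [hu] chooses a representative of the coset encoded by a word. *)
pose hu (u : {ffun 'I_n -> 'I_m}) := odflt 1%g [pick h | wact rw h == u].
have huP h : E *m row_sym s rG *m rG h = E *m row_sym s rG *m rG (hu (wact rw h)).
  rewrite /hu; case: pickP => [h' /eqP e|/(_ h)]; last by rewrite eqxx.
  rewrite -(mulgKV h' h) repr_perm_mul -!mulmxA (mulmxA (row_sym _ _)).
  rewrite row_symM ?mulmxA // inE; apply/forallP => i; rewrite permM.
  have := congr1 (fun w : {ffun 'I_n -> 'I_m} => nat_of_ord (w (h i))) e.
  by rewrite !ffunE permK /= => ->.
pose V := (\sum_(u in row_words ns sm) <<E *m row_sym s rG *m rG (hu u)>>)%MS.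
apply: (@leq_trans (\rank V)).
  apply: mxrankS; apply: gen_module_sub => g _.
  have -> : E *m young s rG *m rG g = \sum_(r in col_stab n s)
      (-1) ^+ odd_perm r *: (E *m row_sym s rG *m rG (r * g)%g).
    rewrite /young mulmxA; move: (E *m row_sym s rG) => A.
    rewrite /col_alt mulmx_sumr mulmx_suml; apply: eq_bigr => r _.
    by rewrite -scalemxAr -scalemxAl repr_perm_mul mulmxA.
  apply: summx_sub => r _; apply: scalemx_sub; rewrite huP.
  apply: (sumsmx_sup (wact rw (r * g)%g)); last by rewrite genmxE.
  exact: imset_f.
apply: leq_trans (mxrank_sums_leq _ _) _.
rewrite -sum_nat_const; apply: leq_sum => u _.
by apply: leq_trans (mxrankM_maxl _ _) (mxrankM_maxr _ _).
Qed.

(** * Weights of far shapes *)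

Lemma sum_row (V : nmodType) n m s (ns : sumn s = n) (sm : (size s <= m)%N)
    (F : nat -> V) :
  \sum_(k < n) F (reshape_index s k) = \sum_(i < m) F i *+ nth 0%N s i.
Proof.
rewrite (partition_big (row_ord ns sm) xpredT) //=; apply: eq_bigr => i _.
rewrite (eq_bigr (fun=> F i)) => [|k /eqP <- //]; rewrite sumr_const.
congr (_ *+ _); apply: (@addnI (sumn (take i s))).
have -> : (sumn (take i s) + nth 0 s i)%N = sumn (take i.+1 s).
  have [js|js] := ltnP i (size s); first by rewrite (take_nth 0%N) // sumn_rcons.
  by rewrite nth_default // !take_oversize ?addn0 // ltnW.
rewrite -!(card_row_lt ns).
rewrite -[RHS](cardsID [set k : 'I_n | (reshape_index s k < i)%N]).
congr (_ + _)%N; apply: eq_card => k; rewrite !inE -?val_eqE /=; lia.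
Qed.

(* Expand [\sum_i (a i - D / 4 * b i) ^+ 2 >= 0], where D is the l1 distance,
   [a i = `|sqrt (p i) - sqrt (q i)|] and [b i = sqrt (p i) + sqrt (q i)]. *)
Lemma hellinger_l1 (R : realType) m (p q : 'I_m -> R) :
  (forall i, 0 <= p i) -> (forall i, 0 <= q i) ->
  \sum_i p i = 1 -> \sum_i q i = 1 ->
  (\sum_i `|p i - q i|) ^+ 2 / 4 <=
    \sum_i (Num.sqrt (p i) - Num.sqrt (q i)) ^+ 2.
Proof.
move=> p0 q0 p1 q1; set D := \sum_i _; set H := \sum_i _.
pose a i := `|Num.sqrt (p i) - Num.sqrt (q i)|.
pose b i := Num.sqrt (p i) + Num.sqrt (q i).
have asq i : a i ^+ 2 = (Num.sqrt (p i) - Num.sqrt (q i)) ^+ 2.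
  by rewrite real_normK ?num_real.
have b0 i : 0 <= b i by rewrite addr_ge0 ?sqrtr_ge0.
have ab i : `|p i - q i| = a i * b i.
  rewrite /a -[b i]ger0_norm // -normrM /b -{1}(sqr_sqrtr (p0 i)).
  by rewrite -{1}(sqr_sqrtr (q0 i)) subr_sqr.
have hb : \sum_i b i ^+ 2 <= 4.
  have -> : (4 : R) = \sum_i (2 * p i + 2 * q i).
    by rewrite big_split -!mulr_sumr p1 q1 /=; ring.
  apply: ler_sum => i _; rewrite /b.
  rewrite -{2}(sqr_sqrtr (p0 i)) -{2}(sqr_sqrtr (q0 i)).
  by have := sqr_ge0 (Num.sqrt (p i) - Num.sqrt (q i)); nra.
have : 0 <= \sum_i (a i - D / 4 * b i) ^+ 2 by apply: sumr_ge0 => i _; exact: sqr_ge0.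
have -> : \sum_i (a i - D / 4 * b i) ^+ 2 =
    H - D / 2 * D + D ^+ 2 / 16 * \sum_i b i ^+ 2.
  rewrite {3}/D !mulr_sumr -sumrN -!big_split /=; apply: eq_bigr => i _.
  by rewrite ab -asq; field.
have := sqr_ge0 D; nra.
Qed.

(* With [q i = s_i / n], the words of content [s] have total [q]-weight at most
   1, and [p i <= q i * expR (2 * (sqrt (p i / q i) - 1))]. *)
Lemma row_words_weight (R : realType) n m s (ns : sumn s = n)
    (sm : (size s <= m)%N) (p : nat -> R) :
  (0 < n)%N -> (forall i, 0 <= p i) -> \sum_(i < m) p i = 1 ->
  #|row_words ns sm|%:R * \prod_(k < n) p (reshape_index s k) <=
    expR (- (n%:R * (\sum_(i < m) `|p i - (nth 0%N s i)%:R / n%:R|) ^+ 2 / 4)).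
Proof.
move=> n0 p0 p1; pose q i : R := (nth 0%N s i)%:R / n%:R.
have nR : (0 : R) < n%:R by rewrite ltr0n.
have q0 i : 0 <= q i by rewrite divr_ge0.
have sum1 (F : nat -> R) : \sum_(k < n) F (reshape_index s k) =
    n%:R * \sum_(i < m) q i * F i.
  rewrite (sum_row ns sm) mulr_sumr; apply: eq_bigr => i _.
  by rewrite /q -mulr_natl; field; rewrite gt_eqF.
have q1 : \sum_(i < m) q i = 1.
  have := sum1 (fun=> 1); rewrite sumr_const card_ord.
  under [in RHS]eq_bigr do rewrite mulr1.
  move=> h; apply: (@mulfI _ n%:R); first by rewrite gt_eqF.
  by rewrite -h mulr1.
have cardq := card_row_words ns sm q0 q1.
have sq i : Num.sqrt (p i) ^+ 2 = p i by rewrite sqr_sqrtr.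
have sqq i : Num.sqrt (q i) ^+ 2 = q i by rewrite sqr_sqrtr.
have pq (k : 'I_n) : p (reshape_index s k) <= q (reshape_index s k) *
    expR (2 * (Num.sqrt (p (reshape_index s k) / q (reshape_index s k)) - 1)).
  set i := reshape_index s k.
  have qi : 0 < q i.
    by rewrite divr_gt0 // ltr0n; apply: leq_ltn_trans (col_lt ns k).
  have x0 : 0 <= Num.sqrt (p i / q i) by apply: sqrtr_ge0.
  rewrite mulrC -ler_pdivrMr // expRM_natl.
  rewrite -[leLHS](sqr_sqrtr (divr_ge0 (p0 i) (q0 i))).
  rewrite lerXn2r ?nnegrE ?expR_ge0 //.
  by have := expR_ge1Dx (Num.sqrt (p i / q i) - 1); rewrite addrC subrK.
apply: (@le_trans _ _ (#|row_words ns sm|%:R * (\prod_(k < n) q (reshape_index s k) *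
  \prod_(k < n) expR (2 * (Num.sqrt (p (reshape_index s k) / q (reshape_index s k)) - 1))))).
  rewrite ler_wpM2l // -big_split /=; apply: ler_prod => k _.
  by rewrite p0 pq.
rewrite mulrA -expR_sum -[leRHS]mul1r.
apply: ler_pM => //.
- by rewrite mulr_ge0 // prodr_ge0.
- by rewrite expR_ge0.
rewrite ler_expR (sum1 (fun i => 2 * (Num.sqrt (p i / q i) - 1))).
rewrite -mulrA -mulrN ler_wpM2l ?ler0n //.
have := @hellinger_l1 R m (fun i => p i) (fun i => q i) (fun i => p0 i)
  (fun i => q0 i) p1 q1.
set H := \sum_i (_ - _) ^+ 2 => hH.
suff -> : \sum_(i < m) q i * (2 * (Num.sqrt (p i / q i) - 1)) = - H by lra.
have -> : H = \sum_(i < m) (p i - q i) +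
    \sum_(i < m) q i * - (2 * (Num.sqrt (p i / q i) - 1)).
  rewrite -big_split /=; apply: eq_bigr => i _.
  have [q0i|qn0] := eqVneq (q i) 0; first by rewrite q0i sqrtr0 subr0 sq; ring.
  rewrite (sqrtrM (q i)^-1 (p0 i)) (sqrtrV (q0 i)) sqrrB sq sqq.
  have : Num.sqrt (q i) != 0 by rewrite -sqrf_eq0 sqq.
  move: (Num.sqrt (p i)) (Num.sqrt (q i)) (sq i) (sqq i) => x y ex ey y0.
  by rewrite -ex -ey; field.
rewrite sumrB p1 q1 subrr add0r -sumrN; apply: eq_bigr => i _.
by rewrite mulrN opprK.
Qed.

(* A finite type indexing the partitions of n into at most m parts. *)
Definition shape_of n m (t : {ffun 'I_m -> 'I_n.+1}) : seq nat :=
  [seq x <- [seq nat_of_ord (t i) | i : 'I_m] | x != 0%N].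

Lemma shape_of_onto n m s : is_part n s -> (size s <= m)%N ->
  exists t : {ffun 'I_m -> 'I_n.+1}, shape_of t = s.
Proof.
move=> /and3P[_ s0 /eqP ns] sm.
exists [ffun i : 'I_m => inord (nth 0%N s i)]; rewrite /shape_of.
have -> : [seq nat_of_ord ([ffun i : 'I_m => inord (nth 0%N s i)] i : 'I_n.+1)
    | i : 'I_m] = s ++ nseq (m - size s) 0%N.
  apply: (@eq_from_nth _ 0%N).
    by rewrite size_map size_enum_ord size_cat size_nseq subnKC.
  move=> i; rewrite size_map size_enum_ord => im.
  rewrite (nth_map (Ordinal im)) ?size_enum_ord // ffunE nth_enum_ord // inordK.
    rewrite nth_cat; case: ltnP => // h; rewrite nth_default // nth_nseq.
    by case: ifP.
  rewrite ltnS -ns; have [is_|h] := ltnP i (size s); last by rewrite nth_default.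
  by rewrite -{2}(cat_take_drop i s) (drop_nth 0%N) // sumn_cat /= addnCA leq_addr.
rewrite filter_cat (_ : [seq x <- s | x != 0%N] = s); last first.
  by apply/all_filterP/allP => x xs; apply: contraNneq s0 => <-.
by elim: (m - size s)%N => [|k IH]; rewrite ?cats0.
Qed.

(** * Submodules cut out by a set of shapes *)

Section PartModule.

Variables (F : fieldType) (n m q : nat) (rG : mx_representation F [set: 'S_n]%G q).

(** Some [t] list their entries out of order, hence the test [is_part]; a shape that occurs for
    several [t] contributes the same subspace each time. *)
Definition part_module k (E : 'M[F]_(k, q)) (P : pred (seq nat)) : 'M_q :=
  (\sum_(t : {ffun 'I_m -> 'I_n.+1} | is_part n (shape_of t) && P (shape_of t))
     gen_module rG (E *m young (shape_of t) rG))%MS.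

Lemma part_module_mod k (E : 'M_(k, q)) P : mxmodule rG (part_module E P).
Proof. by apply: sumsmx_module => t _; apply: gen_module_mod. Qed.

Lemma young_module s k (E : 'M_(k, q)) : mxmodule rG E -> (E *m young s rG <= E)%MS.
Proof.
move=> /mxmoduleP modE.
rewrite /young mulmxA; apply: (@submx_trans _ _ _ _ _ _ (E *m col_alt s rG)).
  apply: submxMr; rewrite /row_sym mulmx_sumr summx_sub // => p _.
  by rewrite modE ?inE.
rewrite /col_alt mulmx_sumr summx_sub // => p _.
by rewrite -scalemxAr scalemx_sub // modE ?inE.
Qed.

End PartModule.

(** Let [U] be a Maschke complement of the sum [X] of both parts. Symmetrizers send [E] into [X] and
    preserve both [X] and [U], so they kill [U :&: (E + X)], which is zero by [young_complete]. *)
Lemma part_module_complete (F : closedFieldType) n m q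
    (rG : mx_representation F [set: 'S_n]%G q) k (E : 'M_(k, q)) P :
  [pchar F] =i pred0 -> mxmodule rG E ->
  (forall s, is_part n s -> (m < size s)%N -> E *m young s rG = 0) ->
  (E <= part_module m rG E P + part_module m rG E (predC P))%MS.
Proof.
move=> F0 modE hE; set X := (_ + _)%MS.
have modX : mxmodule rG X by rewrite addsmx_module ?part_module_mod.
have F'G := pchar0_group n F0.
have [U modU sU dU] := mx_Maschke_pchar rG F'G modX (submx1 X).
have modEU : mxmodule rG (U :&: (E + X))%MS.
  by rewrite capmx_module // addsmx_module.
suff EU0 : (U :&: (E + X))%MS = 0.
  (* Modular law: [X = X + U :&: (E + X) = (X + U) :&: (E + X)], and [X + U] is the whole space. *)
  rewrite -[X](@addsmx0_id _ q q) -EU0 (matrix_modl U (addsmxSr E X)).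
  rewrite sub_capmx addsmxSl andbT; apply: submx_trans (submx1 E) _.
  by rewrite sU.
apply: (young_complete F0 modEU) => s sP.
have YX : (E *m young s rG <= X)%MS.
  have [sm|sm] := leqP (size s) m; last by rewrite hE // sub0mx.
  have [t et] := shape_of_onto sP sm.
  have [Ps|Ps] := boolP (P s).
    apply: submx_trans (addsmxSl _ _); apply: (sumsmx_sup t); rewrite et ?sP //.
    exact: gen_module_id.
  apply: submx_trans (addsmxSr _ _); apply: (sumsmx_sup t); rewrite et ?sP //=.
  exact: gen_module_id.
apply/eqP; rewrite -submx0 -(mxdirect_addsP dU) sub_capmx; apply/andP; split.
  apply: submx_trans (submxMr _ (capmxSr _ _)) _.
  rewrite addsmxMr addsmx_sub YX young_module //.
apply: submx_trans (young_module s modU).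
by apply: submxMr; apply: capmxSl.
Qed.

Section Far.

Variables (F : fieldType) (R : realType) (n m : nat) (p : nat -> R) (eps : R).
Hypotheses (F0 : [pchar F] =i pred0) (n0 : (0 < n)%N).
Hypotheses (p0 : forall i, 0 <= p i) (p1 : \sum_(i < m) p i = 1).
Hypothesis pd : {homo p : i j / (i <= j)%N >-> j <= i}.
Hypothesis eps0 : 0 <= eps.

Definition far (s : seq nat) : bool :=
  eps < \sum_(i < m) `|p i - (nth 0%N s i)%:R / n%:R|.

Local Notation B := (expR (- (n%:R * eps ^+ 2 / 4))).

(** The rank is at most the number of words of content [s] times a polynomial factor, and those
    words have exponentially small total weight. *)
Lemma far_gen_rank s k (E : 'M[F]_(k, _)) :
  is_part n s -> (size s <= m)%N -> far s ->
  \prod_(i < n) p (reshape_index s i) *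
    (\rank (gen_module (word_repr F n m) (E *m young s (word_repr F n m))))%:R <=
  (n.+1 ^ (m * m))%:R * B.
Proof.
move=> /and3P[_ _ /eqP ns] sm fs; set w := \prod_(i < n) _.
have w0 : 0 <= w by apply: prodr_ge0.
have r1 := rank_gen_young ns sm (word_repr F n m) E.
have r2 := rank_row_sym F ns sm.
apply: (@le_trans _ _ (w * (#|row_words ns sm| * n.+1 ^ (m * m))%:R)).
  rewrite ler_wpM2l // ler_nat; apply: leq_trans r1 _.
  by rewrite leq_mul2l r2 orbT.
rewrite natrM mulrA [leRHS]mulrC ler_wpM2r ?ler0n // mulrC.
apply: le_trans (row_words_weight ns sm n0 p0 p1) _.
rewrite ler_expR lerN2; apply: ler_wpM2r; first by rewrite invr_ge0.
apply: ler_wpM2l => //.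
rewrite lerXn2r ?nnegrE //; first by apply: sumr_ge0.
exact: ltW.
Qed.

(** There are [n.+1 ^ m] indices [t]; each one has a vanishing image or a shape of weight at least
    [w]. *)
Lemma far_part_rank (w : R) k (E : 'M[F]_(k, _)) : 0 <= w ->
  (forall s, is_part n s -> E *m young s (word_repr F n m) != 0 ->
     (size s <= m)%N /\ w <= \prod_(i < n) p (reshape_index s i)) ->
  w * (\rank (part_module m (word_repr F n m) E far))%:R <=
    (n.+1 ^ m)%:R * ((n.+1 ^ (m * m))%:R * B).
Proof.
move=> w0 hE; pose rk t := \rank (gen_module (word_repr F n m)
  (E *m young (@shape_of n m t) (word_repr F n m))).
have B0 : 0 <= (n.+1 ^ (m * m))%:R * B by rewrite mulr_ge0 ?expR_ge0.
apply: (@le_trans _ _ (\sum_(t | is_part n (@shape_of n m t) && far (shape_of t))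
    w * (rk t)%:R)).
  rewrite -mulr_sumr -natr_sum ler_wpM2l // ler_nat.
  rewrite /part_module; elim/big_ind2 : _ => [|a A' b B' h1 h2|i _]; rewrite ?mxrank0 //.
  exact: leq_trans (mxrank_adds_leqif _ _) (leq_add h1 h2).
have -> : (n.+1 ^ m)%N = #|{: {ffun 'I_m -> 'I_n.+1}}| by rewrite card_ffun !card_ord.
rewrite mulr_natl -sumr_const big_mkcond /=; apply: ler_sum => t _.
case: ifP => // /andP[tP tf].
have [e|nz] := eqVneq (E *m young (shape_of t) (word_repr F n m)) 0.
  rewrite /rk e (_ : gen_module _ _ = 0) ?mxrank0 ?mulr0 //.
  by apply/eqP; rewrite -submx0; apply: gen_module_sub => g _; rewrite mul0mx sub0mx.
have [sm wle] := hE _ tP nz.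
apply: le_trans (far_gen_rank E tP sm tf).
by rewrite ler_wpM2r // ler0n.
Qed.

(* The [p]-weighted ranks of the content spaces sum to 1, those of their far
   parts to less than 1/2. *)
Lemma far_content :
  (n.+1 ^ m)%:R * ((n.+1 ^ m)%:R * ((n.+1 ^ (m * m))%:R * B)) < 1 / 2 ->
  exists b : {ffun 'I_m -> 'I_n.+1},
    (2 * \rank (part_module m (word_repr F n m) (content_proj F b) far) <
       \rank (content_proj F b))%N.
Proof.
move=> hB; apply: boolp.contrapT => h.
have {}h b : ((\rank (content_proj F b))%:R : R) <=
    2 * (\rank (part_module m (word_repr F n m) (content_proj F b) far))%:R.
  by rewrite -natrM ler_nat leqNgt; apply/negP => hb; apply: h; exists b.
pose w b : R := \prod_(i < m) p i ^+ (b : {ffun 'I_m -> 'I_n.+1}) i.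
have w0 b : 0 <= w b by apply: prodr_ge0 => i _; rewrite exprn_ge0.
have : \sum_b w b * (\rank (content_proj F b))%:R = 1.
  have e1 : \sum_(f : {ffun 'I_n -> 'I_m}) \prod_k p (f k) = 1.
    rewrite -(bigA_distr_bigA (fun k (i : 'I_m) => p i)) /=.
    by rewrite big1 // => k _.
  rewrite -[RHS]e1 (partition_big (@content n m) xpredT) //=; apply: eq_bigr => b _.
  rewrite rank_content_proj -sumr_const mulr_sumr; apply: eq_big => f.
    by rewrite inE.
  by rewrite inE => /eqP <-; rewrite mulr1 (prod_content (fun i : 'I_m => p i)).
apply/eqP; rewrite lt_eqF //.
apply: (@le_lt_trans _ _ (\sum_(b : {ffun 'I_m -> 'I_n.+1})
   2 * ((n.+1 ^ m)%:R * ((n.+1 ^ (m * m))%:R * B)))).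
  apply: ler_sum => b _; apply: le_trans (ler_wpM2l (w0 b) (h b)) _.
  rewrite mulrCA ler_wpM2l //; apply: far_part_rank => // s sP nz.
  exact: word_young_weight nz p0 pd.
rewrite sumr_const card_ffun !card_ord -mulr_natl; lra.
Qed.

Lemma young_word_size s : is_part n s ->
  (m < size s)%N -> forall k (E : 'M[F]_(k, _)), E *m young s (word_repr F n m) = 0.
Proof.
move=> sP ms k E; have -> : young s (word_repr F n m) = 0; last by rewrite mulmx0.
rewrite -[LHS]mul1mx -sum_content_proj mulmx_suml big1 // => b _.
apply/eqP; apply: contraT => nz.
have [sm _] := word_young_weight F0 sP nz p0 pd.
by rewrite leqNgt ms in sm.
Qed.

End Far.

(** Under the uniform weight every word weighs [m%:R ^- n], so weighted ranks are proportions of the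
    full dimension. *)
Lemma far_uniform (F : fieldType) (R : realType) n m (eps : R) :
  [pchar F] =i pred0 -> (0 < n)%N -> (0 < m)%N -> 0 <= eps ->
  (n.+1 ^ m)%:R * ((n.+1 ^ (m * m))%:R * expR (- (n%:R * eps ^+ 2 / 4))) <= 1 / 4 ->
  (4 * \rank (part_module m (word_repr F n m) 1%:M
     (far n m (fun=> m%:R^-1) eps)) <= m ^ n)%N.
Proof.
move=> F0 n0 m0 e0 hB; have mR : (0 : R) < m%:R by rewrite ltr0n.
have p1 : \sum_(i < m) (m%:R^-1 : R) = 1.
  by rewrite sumr_const card_ord -[_ *+ _]mulr_natl mulfV // gt_eqF.
have pp (i : nat) : (0 : R) <= m%:R^-1 by rewrite invr_ge0 ltW.
have := @far_part_rank F R n m (fun=> m%:R^-1) eps n0 pp p1 e0 (m%:R ^- n) _ 1%:M.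
rewrite invr_ge0 exprn_ge0 ?ler0n // => /(_ isT) h.
have {}h := h _; have : m%:R ^- n * (\rank (part_module m (word_repr F n m) 1%:M
     (far n m (fun=> m%:R^-1) eps)))%:R <= (1 / 4 : R).
  apply: le_trans hB; apply: h => s sP nz; split; last first.
    by rewrite prodr_const card_ord exprVn.
  rewrite leqNgt; apply: contraNN nz => ms.
  have pc : {homo (fun=> m%:R^-1 : R) : i j / (i <= j)%N >-> j <= i} by [].
  by rewrite (young_word_size F0 pp pc sP ms).
rewrite mulrC ler_pdivrMr ?exprn_gt0 // => h2.
rewrite -(ler_nat R) natrM natrX; clear -h2; lra.
Qed.

(** * Frobenius norm and orthogonal projections *)

Section Frobenius.

Variable C : numClosedFieldType.

(** The square of the Frobenius norm. *)
Definition frob m n (A : 'M[C]_(m, n)) : C := \sum_i \sum_j `|A i j| ^+ 2.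

Lemma frobE m n (A : 'M[C]_(m, n)) : frob A = \tr (A *m A^t*).
Proof.
rewrite /mxtrace; apply: eq_bigr => i _; rewrite mxE; apply: eq_bigr => j _.
by rewrite !mxE normCK.
Qed.

Lemma frob_ge0 m n (A : 'M[C]_(m, n)) : 0 <= frob A.
Proof. by apply: sumr_ge0 => i _; apply: sumr_ge0 => j _; rewrite exprn_ge0. Qed.

Lemma adjM m n p (A : 'M[C]_(m, n)) (B : 'M[C]_(n, p)) :
  (A *m B)^t* = B^t* *m A^t*.
Proof. by rewrite trmx_mul map_mxM. Qed.

Lemma adjK m n (A : 'M[C]_(m, n)) : (A^t*)^t* = A.
Proof. by apply/matrixP => i j; rewrite !mxE conjCK. Qed.

Lemma adj1 n : (1%:M : 'M[C]_n)^t* = 1%:M.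
Proof. by rewrite trmx1 map_mx1. Qed.

Lemma frob_adj m n (A : 'M[C]_(m, n)) : frob (A^t*) = frob A.
Proof. by rewrite !frobE adjK mxtrace_mulC. Qed.

Section Projection.

Variables (r n : nat) (u : 'M[C]_(r, n)).
Hypothesis uu : u *m u^t* = 1%:M.
Local Notation P := (u^t* *m u).
Local Notation P' := (1%:M - u^t* *m u).

Lemma proj_idem : P *m P = P.
Proof. by rewrite mulmxA -(mulmxA _ u) uu mulmx1. Qed.

Lemma proj_adj : P^t* = P.
Proof. by rewrite adjM adjK. Qed.

Lemma coproj_adj : P'^t* = P'.
Proof. by rewrite [_^T]raddfB map_mxB [map_mx _ _]adj1 [X in _ - X]proj_adj. Qed.

Lemma frob_pythagoras k (A : 'M_(n, k)) : frob A = frob (P *m A) + frob (P' *m A).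
Proof.
rewrite !frobE (adjM P A) (adjM P' A) proj_adj coproj_adj.
move: (u^t* *m u) proj_idem => Q QQ.
rewrite mxtrace_mulC [X in _ = X + _]mxtrace_mulC [X in _ = _ + X]mxtrace_mulC.
have QQ' : Q *m Q + (1%:M - Q) *m (1%:M - Q) = 1%:M.
  by rewrite mulmxBl mul1mx mulmxBr mulmx1 QQ subrr subr0 addrC subrK.
rewrite -!mulmxA (mulmxA Q) (mulmxA (1%:M - Q)).
by rewrite -mxtraceD -mulmxDr -mulmxDl QQ' mul1mx.
Qed.

Lemma bessel k (A : 'M_(n, k)) : frob (u *m A) <= frob A.
Proof.
have -> : frob (u *m A) = frob (P *m A).
  rewrite !frobE (adjM u A) (adjM P A) proj_adj mxtrace_mulC [RHS]mxtrace_mulC.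
  by rewrite -(mulmxA _ P) (mulmxA P P) proj_idem -!mulmxA.
by rewrite (frob_pythagoras A) lerDl frob_ge0.
Qed.

(** The unitary cancels in the trace, leaving the trace of a projection of corank [r]. *)
Lemma frob_coproj_unitary (U : 'M[C]_n) : U *m U^t* = 1%:M ->
  frob (P' *m U) = n%:R - r%:R.
Proof.
move=> UU; rewrite frobE (adjM P' U) mulmxA -(mulmxA P') UU mulmx1.
rewrite coproj_adj mulmxBl mul1mx mulmxBr mulmx1 proj_idem.
by rewrite subrr subr0 raddfB /= mxtrace1 mxtrace_mulC uu mxtrace1.
Qed.

End Projection.
End Frobenius.

(** * Trace inequality for orthogonal unitaries *)

Section TraceBound.

Variables (C : numClosedFieldType) (N n : nat) (U : 'I_N -> 'M[C]_n).
Hypothesis U_unitary : forall i, U i *m (U i)^t* = 1%:M.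
Hypothesis U_orth : forall i j, \tr (U i *m (U j)^t*) = n%:R *+ (i == j).

Definition combine (w : 'rV[C]_N) : 'M[C]_n := \sum_i w 0 i *: U i.

Lemma combine_linear : linear combine.
Proof.
move=> a v w; rewrite /combine scaler_sumr -big_split /=; apply: eq_bigr => i _.
by rewrite !mxE scalerDl scalerA.
Qed.

HB.instance Definition _ :=
  GRing.isSemilinear.Build _ _ _ _ combine (GRing.semilinear_linear combine_linear).

Lemma U_unitary_l i : (U i)^t* *m U i = 1%:M.
Proof. exact: mulmx1C. Qed.

Lemma frob_combine w : frob (combine w) = n%:R * frob w.
Proof.
rewrite frobE {1}/combine mulmx_suml raddf_sum /=.
rewrite /frob big_ord1 mulr_sumr; apply: eq_bigr => i _.
have -> : (combine w)^t* = \sum_j (w 0 j)^* *: (U j)^t*.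
  rewrite /combine !raddf_sum /=; apply: eq_bigr => j _.
  by rewrite [_^T]linearZ map_mxZ.
rewrite mulmx_sumr raddf_sum (bigD1 i) //= big1 ?addr0 => [|j ji].
  rewrite -scalemxAl -scalemxAr !linearZ /= U_orth eqxx mulr1n.
  by rewrite mulrA mulrC -normCK.
by rewrite -scalemxAl -scalemxAr !linearZ /= U_orth eq_sym (negbTE ji) !mulr0.
Qed.

Lemma frob_col m (v : 'cV[C]_m) : frob v = \sum_i `|v i 0| ^+ 2.
Proof. by apply: eq_bigr => i _; rewrite big_ord1. Qed.

(** For a fixed entry [(a, b)], the values at the rows of [u] are the coordinates of [u] applied to
    the vector of entries [L (U j) a b], so [bessel] applies to each entry separately. *)
Lemma sum_frob_bessel r (u : 'M[C]_(r, N)) (S : {set 'I_N}) (L : 'M[C]_n -> 'M[C]_n) :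
  linear L -> u *m u^t* = 1%:M -> (forall i j, j \notin S -> u i j = 0) ->
  \sum_i frob (L (combine (row i u))) <= \sum_(j in S) frob (L (U j)).
Proof.
move=> linL uu uS.
have LE i a b : L (combine (row i u)) a b =
    (u *m (\col_j if j \in S then L (U j) a b else 0)) i 0.
  pose lL := GRing.isSemilinear.Build _ _ _ _ L (GRing.semilinear_linear linL).
  pose L' : {linear 'M[C]_n -> 'M[C]_n} := HB.pack L lL.
  rewrite -[L]/(L' : _ -> _) /combine linear_sum summxE !mxE; apply: eq_bigr => j _.
  rewrite linearZ !mxE; case: ifP => // /negbT jS.
  by rewrite uS // !mul0r.
under eq_bigr do (rewrite /frob; under eq_bigr do under eq_bigr do rewrite LE).
rewrite exchange_big /= [leRHS]exchange_big /=; apply: ler_sum => a _.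
rewrite exchange_big /= [leRHS]exchange_big /=; apply: ler_sum => b _.
set v := (\col_j _); have := bessel uu v.
rewrite !frob_col.
move=> /le_trans; apply; rewrite [leRHS]big_mkcond /=; apply: ler_sum => j _.
by rewrite mxE; case: ifP => //; rewrite normr0 expr0n.
Qed.

(* If P and Q are the orthogonal projections onto the row spaces of X and of the
   conjugate of Y, then P M Q = 0 forces
   n = |M|^2 <= |(1 - P) M|^2 + |M (1 - Q)|^2 for every M = combine w with w a
   unit vector of W; sum over an orthonormal basis of W and apply Bessel. *)
Lemma rank_annihilated_le k a b (W : 'M[C]_(k, N)) (X : 'M[C]_(a, n))
    (Y : 'M[C]_(b, n)) (S : {set 'I_N}) :
  (forall i j, j \notin S -> W i j = 0) ->
  (forall i, X *m combine (row i W) *m Y^T = 0) ->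
  (\rank W * n <= #|S| * ((n - \rank X) + (n - \rank Y)))%N.
Proof.
move=> WS XWY.
have basis c (A : 'M[C]_(c, n)) : exists p : 'M[C]_(\rank A, n),
    p *m p^t* = 1%:M /\ (p <= A)%MS.
  exists (schmidt (row_base A)); split.
    by apply/unitarymxP/schmidt_unitarymx/rank_leq_col.
  by rewrite (eqmx_schmidt_free (row_base_free A)) eq_row_base.
have [px [pxu /submxP[cx ex]]] := basis _ X.
have [py [pyu /submxP[cy ey]]] := basis _ Y.
have [u [uu /submxP[cu eu]]] : exists u : 'M[C]_(\rank W, N),
    u *m u^t* = 1%:M /\ (u <= W)%MS.
  exists (schmidt (row_base W)); split.
    by apply/unitarymxP/schmidt_unitarymx/rank_leq_col.
  by rewrite (eqmx_schmidt_free (row_base_free W)) eq_row_base.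
have uS i j : j \notin S -> u i j = 0.
  by move=> jS; rewrite eu mxE big1 // => l _; rewrite WS ?mulr0.
have XuY i : px *m combine (row i u) *m py^T = 0.
  have -> : row i u = \sum_l cu i l *: row l W.
    by rewrite eu row_mul mulmx_sum_row; apply: eq_bigr => l _; rewrite mxE.
  rewrite [combine _]linear_sum mulmx_sumr mulmx_suml big1 // => l _.
  rewrite linearZ /= -scalemxAr -scalemxAl ex ey trmx_mul.
  by rewrite -!mulmxA (mulmxA X) (mulmxA (X *m _)) XWY mul0mx mulmx0 scaler0.
pose z := (py^T)^t*.
have eQ : z^t* = py^T by rewrite /z adjK.
have zz : z *m z^t* = 1%:M.
  rewrite eQ /z trmxK; have -> : py^T = map_mx Num.conj (py^t*).
    by apply/matrixP => i j; rewrite !mxE conjCK.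
  by rewrite -map_mxM pyu map_mx1.
pose P' := 1%:M - px^t* *m px; pose Q' := 1%:M - z^t* *m z.
have key i : (n%:R : C) <= frob (P' *m combine (row i u)) +
    frob (combine (row i u) *m Q').
  set M := combine (row i u).
  have <- : frob M = n%:R.
    rewrite frob_combine.
    have -> : frob (row i u) = 1; last by rewrite mulr1.
    have <- : (u *m u^t*) i i = 1 by rewrite uu mxE eqxx.
    rewrite /frob big_ord1 mxE; apply: eq_bigr => j _.
    by rewrite !mxE normCK.
  rewrite (frob_pythagoras pxu M) addrC lerD2l.
  (* [P M Q = 0] gives [P M = P M (1 - Q)], and projecting by [P] does not increase the norm. *)
  have -> : px^t* *m px *m M = px^t* *m px *m (M *m Q').
    by rewrite mulmxBr mulmx1 mulmxBr eQ !mulmxA -(mulmxA _ px M)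
       -(mulmxA _ _ py^T) XuY mulmx0 mul0mx subr0.
  by rewrite [leRHS](frob_pythagoras pxu) lerDl frob_ge0.
have : \sum_(i < \rank W) (n%:R : C) <= \sum_(j in S)
    ((n - \rank X) + (n - \rank Y))%:R.
  apply: (@le_trans _ _ (\sum_i frob (P' *m combine (row i u)) +
    \sum_i frob (combine (row i u) *m Q'))).
    by rewrite -big_split; apply: ler_sum => j _; apply: key.
  under [leRHS]eq_bigr do rewrite natrD.
  rewrite big_split /=; apply: lerD.
    apply: le_trans (@sum_frob_bessel _ u S (mulmx P') _ uu uS) _.
      by move=> c A B; rewrite linearP.
    apply: ler_sum => j _; rewrite frob_coproj_unitary //.
    by rewrite natrB ?rank_leq_col.
  apply: le_trans (@sum_frob_bessel _ u S (mulmxr Q') _ uu uS) _.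
    by move=> c A B; rewrite linearP.
  apply: ler_sum => j _ /=; rewrite -frob_adj (adjM (U j)) (coproj_adj z).
  rewrite (frob_coproj_unitary zz) ?adjK ?U_unitary_l //.
  by rewrite natrB ?rank_leq_col.
by rewrite !sumr_const card_ord -!mulrnA ler_nat mulnC [X in (_ <= X)%N]mulnC.
Qed.

End TraceBound.

(** * Clock-and-shift unitaries *)

(** The separable polynomial ['X^n - 1] has [n] distinct roots, and such a set of roots of unity
    contains a primitive one. *)
Lemma prim_root_exists (C : numClosedFieldType) n : (0 < n)%N ->
  exists z : C, n.-primitive_root z.
Proof.
move=> n0; have [roots] := closed_field_poly_normal ('X^n - 1 : {poly C}).
rewrite (monicP (monicXnsubC 1 n0)) scale1r => fact.
have sep : uniq roots.
  by rewrite -separable_prod_XsubC -fact separable_Xn_sub_1 // pnatr_eq0 -lt0n.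
have /hasP[w _ wP] : has n.-primitive_root roots; last by exists w.
apply: has_prim_root => //.
  by apply/allP => w; rewrite -root_prod_XsubC -fact.
have := congr1 (size : {poly C} -> nat) fact.
by rewrite size_XnsubC // size_prod_XsubC => -[->].
Qed.

Section ClockShift.

Variables (C : numClosedFieldType) (d : nat) (z : C).
Hypotheses (d0 : (0 < d)%N) (zP : d.-primitive_root z).

(* The index [j < d ^ 2] encodes the shift [j %/ d] and the clock [j %% d]. *)
Definition clock_shift (j : 'I_(d ^ 2)) (a b : 'I_d) : C :=
  if b == ((a + j %/ d) %% d)%N :> nat then z ^+ (j %% d * a) else 0.

Lemma conj_prim_root : z * z^* = 1.
Proof.
rewrite -normCK; have : `|z| ^+ d = 1 by rewrite -normrX (prim_expr_order zP) normr1.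
by move/eqP; rewrite pexpr_eq1 // => /eqP ->; rewrite expr1n.
Qed.

Lemma conj_prim_rootX k : z ^+ k * (z ^+ k)^* = 1.
Proof. by rewrite rmorphXn -exprMn conj_prim_root expr1n. Qed.

(** For [s != t] this is a geometric sum whose ratio [x] satisfies [x != 1] and [x ^+ d = 1]. *)
Lemma sum_prim_root s t : (s < d)%N -> (t < d)%N ->
  \sum_(a < d) z ^+ (s * a) * (z ^+ (t * a))^* = d%:R *+ (s == t).
Proof.
move=> sd td; have [->|st] := eqVneq s t.
  under eq_bigr do rewrite conj_prim_rootX.
  by rewrite sumr_const card_ord mulr1n.
pose x := z ^+ s * (z ^+ t)^*.
have -> : \sum_(a < d) z ^+ (s * a) * (z ^+ (t * a))^* = \sum_(a < d) x ^+ a.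
  by apply: eq_bigr => a _; rewrite exprMn -rmorphXn -!exprM.
have x1 : x - 1 != 0.
  apply: contraNneq st => /eqP; rewrite subr_eq0 => /eqP e.
  have : z ^+ s = z ^+ t.
    by rewrite -[RHS]mul1r -e -mulrA [_^* * _]mulrC conj_prim_rootX mulr1.
  by move/eqP; rewrite (eq_prim_root_expr zP) !modn_small.
apply: (mulfI x1); rewrite mulr0n mulr0 -subrX1 /x exprMn -rmorphXn -!exprM.
by rewrite ![(_ * d)%N]mulnC !exprM (prim_expr_order zP) !expr1n rmorph1 mulr1 subrr.
Qed.

Lemma shift_eq (a a' s : nat) : (a < d)%N -> (a' < d)%N ->
  ((a + s) %% d == (a' + s) %% d)%N = (a == a').
Proof. by move=> h h'; rewrite eqn_modDr !modn_small. Qed.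

Lemma clock_shift_unitary j a a' :
  \sum_b clock_shift j a b * (clock_shift j a' b)^* = (a == a')%:R.
Proof.
have ms : ((a + j %/ d) %% d < d)%N by rewrite ltn_mod.
rewrite (bigD1 (Ordinal ms)) //= big1 ?addr0 => [|b]; last first.
  by rewrite -val_eqE /clock_shift /= => /negbTE ->; rewrite mul0r.
rewrite /clock_shift /= eqxx shift_eq // -val_eqE /=.
by case: eqP => [->|_]; rewrite ?conj_prim_rootX ?conjC0 ?mulr0.
Qed.

Lemma clock_shift_orth j j' :
  \sum_a \sum_b clock_shift j a b * (clock_shift j' a b)^* = d%:R *+ (j == j').
Proof.
have lt (i : 'I_(d ^ 2)) : (i %/ d < d)%N by rewrite ltn_divLR // -expn2 ltn_ord.
have e a : \sum_b clock_shift j a b * (clock_shift j' a b)^* =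
    (z ^+ (j %% d * a) * (z ^+ (j' %% d * a))^*) *+ (j %/ d == j' %/ d)%N.
  have ms : ((a + j %/ d) %% d < d)%N by rewrite ltn_mod.
  rewrite (bigD1 (Ordinal ms)) //= big1 ?addr0 => [|b]; last first.
    by rewrite -val_eqE /clock_shift /= => /negbTE ->; rewrite mul0r.
  rewrite /clock_shift /= eqxx ![(a + _)%N]addnC shift_eq //.
  by case: eqP => _ //; rewrite conjC0 mulr0.
under eq_bigr do rewrite e.
rewrite sumrMnl sum_prim_root ?ltn_mod // -mulrnA mulnb; congr (_ *+ nat_of_bool _).
apply/andP/eqP => [[/eqP h1 /eqP h2]|->]; last by rewrite !eqxx.
by apply: val_inj; rewrite /= (divn_eq j d) h1 h2 -divn_eq.
Qed.

End ClockShift.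

Section WordUnitary.

Variables (C : numClosedFieldType) (n d e : nat) (u : 'I_e -> 'I_d -> 'I_d -> C).
Hypothesis u_unitary : forall j a a', \sum_b u j a b * (u j a' b)^* = (a == a')%:R.
Hypothesis u_orth : forall j j',
  \sum_a \sum_b u j a b * (u j' a b)^* = d%:R *+ (j == j').

Local Notation word := {ffun 'I_n -> 'I_d}.

(** The tensor product of the matrices [u (f k)], with words as multi-indices. Sums over words then
    factor into sums over single letters. *)
Definition word_unitary (f : {ffun 'I_n -> 'I_e}) : 'M[C]_#|{: word}| :=
  \matrix_(x, y) \prod_k u (f k) ((enum_val x : word) k) ((enum_val y : word) k).

Lemma word_unitaryP f : word_unitary f *m (word_unitary f)^t* = 1%:M.
Proof.
apply/matrixP => x x'; rewrite !mxE.
pose F (y : word) := \prod_k (u (f k) ((enum_val x : word) k) (y k) *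
  (u (f k) ((enum_val x' : word) k) (y k))^*).
rewrite (eq_bigr (fun y => F (enum_val y))) => [|y _]; last first.
  by rewrite !mxE rmorph_prod -big_split.
rewrite -(big_enum_val (A := {: word}) F) (eq_bigl xpredT) // /F.
rewrite -(bigA_distr_bigA (fun k b => u (f k) ((enum_val x : word) k) b *
  (u (f k) ((enum_val x' : word) k) b)^*)).
under eq_bigr do rewrite u_unitary.
have [->|ne] := eqVneq x x'; first by apply: big1 => k _; rewrite eqxx.
have [k hk] : exists k, (enum_val x : word) k != (enum_val x' : word) k.
  apply/existsP; rewrite -negb_forall; apply: contraNN ne => /forallP h.
  by apply/eqP/enum_val_inj/ffunP => k; apply/eqP.
by rewrite (bigD1 k) //= (negbTE hk) mul0r.
Qed.

Lemma word_unitary_orth f g :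
  \tr (word_unitary f *m (word_unitary g)^t*) = #|{: word}|%:R *+ (f == g).
Proof.
pose F (x y : word) := \prod_k (u (f k) (x k) (y k) * (u (g k) (x k) (y k))^*).
rewrite /mxtrace.
rewrite (eq_bigr (fun x => \sum_y F (enum_val x) y)) => [|x _]; last first.
  transitivity (\sum_(y in {: word}) F (enum_val x) y); last exact: eq_bigl.
  rewrite mxE [RHS]big_enum_val /=; apply: eq_bigr => y _.
  by rewrite !mxE rmorph_prod -big_split.
rewrite -(big_enum_val (A := {: word}) (fun x => \sum_y F x y)) (eq_bigl xpredT) //.
rewrite (eq_bigr (fun x : word => \prod_k \sum_b
   (u (f k) (x k) b * (u (g k) (x k) b)^*))) => [|x _]; last first.
  by rewrite bigA_distr_bigA.
rewrite -(bigA_distr_bigA (fun k a => \sum_b (u (f k) a b * (u (g k) a b)^*))) /=.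
under eq_bigr do rewrite u_orth.
have [->|ne] := eqVneq f g.
  under eq_bigr do rewrite eqxx mulr1n.
  by rewrite prodr_const card_ord card_ffun !card_ord natrX mulr1n.
have [k hk] : exists k, f k != g k.
  apply/existsP; rewrite -negb_forall; apply: contraNN ne => /forallP h.
  by apply/eqP/ffunP => k; apply/eqP.
by rewrite (bigD1 k) //= (negbTE hk) mulr0n mul0r mulr0n.
Qed.

End WordUnitary.

(** * Invariants of Specht modules *)

Section Trilinear.

Variables (F : fieldType) (gT : finGroupType) (G : {group gT}) (m1 m2 m3 : nat).
Variables (r1 : mx_representation F G m1) (r2 : mx_representation F G m2).
Variable r3 : mx_representation F G m3.
Variable t : 'I_m1 -> 'I_m2 -> 'I_m3 -> F.

Definition trilinear (a : 'rV[F]_m1) (b : 'rV_m2) (c : 'rV_m3) : F :=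
  \sum_i \sum_j \sum_k a 0 i * b 0 j * c 0 k * t i j k.

(** An invariant form takes [#|G|] times its value on the sum of the translates of a tensor. That
    sum is an invariant tensor, hence zero. *)
Lemma trilinear_invariant_eq0 : [pchar F] =i pred0 ->
  (forall g a b c, g \in G ->
     trilinear (a *m r1 g) (b *m r2 g) (c *m r3 g) = trilinear a b c) ->
  \rank (rfix_mx (prod_repr (prod_repr r1 r2) r3) G) = 0%N ->
  forall a b c, trilinear a b c = 0.
Proof.
move=> F0 tG /eqP; rewrite mxrank_eq0 => /eqP fix0 a b c.
set rho := prod_repr _ _ in fix0.
have avg0 : \sum_(g in G) rho g = 0.
  suff hs : ((\sum_(g in G) rho g)%R <= rfix_mx rho G)%MS.
    by rewrite fix0 submx0 in hs; apply/eqP.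
  apply/rfix_mxP => h Gh.
  rewrite mulmx_suml [RHS](reindex_inj (mulIg h)) /=.
  apply: eq_big => [g|g Gg]; first by rewrite groupMr.
  exact: esym (repr_mxM rho Gg Gh).
pose ev (x : 'rV[F]_m1) (y : 'rV[F]_m2) (w : 'rV[F]_m3) := tprod (tprod x y) w.
pose dual i j k := tprod (tprod (delta_mx i 0 : 'cV[F]_m1) (delta_mx j 0 : 'cV[F]_m2))
  (delta_mx k 0 : 'cV[F]_m3).
(* [col] represents the form as a linear functional on the tensor product; the trace reads off a
   matrix with a single entry. *)
pose col := \sum_i \sum_j \sum_k t i j k *: dual i j k.
have evE x y w : \tr (ev x y w *m col) = trilinear x y w.
  rewrite mulmx_sumr raddf_sum; apply: eq_bigr => i _.
  rewrite mulmx_sumr raddf_sum; apply: eq_bigr => j _.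
  rewrite mulmx_sumr raddf_sum; apply: eq_bigr => k _ /=.
  rewrite -scalemxAr linearZ /= /ev /dual -!tprodE !mxtrace_prod mulrC.
  have tr1 m (v : 'rV[F]_m) l : \tr (v *m delta_mx l 0) = v 0 l.
    by rewrite -colE trace_mx11 mxE.
  by rewrite !tr1.
have : #|G|%:R * trilinear a b c = 0.
  rewrite mulr_natl -sumr_const -(eq_bigr _ (fun i Gi => tG i a b c Gi)).
  under eq_bigr do rewrite -evE.
  rewrite -raddf_sum -mulmx_suml /=.
  have -> : \sum_(g in G) ev (a *m r1 g) (b *m r2 g) (c *m r3 g) =
      ev a b c *m \sum_(g in G) rho g.
    by rewrite mulmx_sumr; apply: eq_bigr => g _; rewrite /ev !tprodE.
  by rewrite avg0 mulmx0 mul0mx raddf0.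
move/eqP; rewrite mulf_eq0 => /orP[|/eqP //].
by have /pcharf0P-> := F0; rewrite -(prednK (cardG_gt0 G)).
Qed.

End Trilinear.

Section SpechtHom.

Variables (F : fieldType) (n : nat) (s : seq nat) (q : nat).
Local Notation G := [set: 'S_n]%G.
Local Notation aG := (regular_repr F G).
Variables (rG : mx_representation F G q) (w : 'rV[F]_q).

Lemma polytabloidE : polytabloid F n s = gring_row (young s aG).
Proof. by rewrite young_regularE. Qed.

(* The homomorphism from the regular module sending the unit to [w]. *)
Definition orbit_mx : 'M[F]_(gcard G, q) := \matrix_(i < gcard G) (w *m rG (enum_val i)).

Lemma orbit_mxE g : gring_row (aG g) *m orbit_mx = w *m rG g.
Proof.
rewrite /gring_row rowK gring_indexK ?inE // mul1g -rowE rowK.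
by rewrite gring_indexK ?inE.
Qed.

Lemma orbit_mx_hom g : aG g *m orbit_mx = orbit_mx *m rG g.
Proof.
apply/row_matrixP => i; rewrite !row_mul !rowK -rowE rowK.
by rewrite gring_indexK ?inE // repr_perm_mul mulmxA.
Qed.

Lemma polytabloid_orbit : polytabloid F n s *m orbit_mx = w *m young s rG.
Proof.
rewrite polytabloidE young_regularE linear_sum mulmx_suml.
rewrite /young {1}/row_sym mulmx_suml mulmx_sumr; apply: eq_bigr => p _.
rewrite linear_sum mulmx_suml mulmx_sumr mulmx_sumr; apply: eq_bigr => r _.
by rewrite linearZ -scalemxAl orbit_mxE repr_perm_mul -!scalemxAr.
Qed.

Local Notation S := (cyclic_mx aG (polytabloid F n s)).

(** The restriction of [orbit_mx] to the Specht module; it sends the polytabloid to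
    [w *m young s rG]. *)
Definition specht_hom : 'M[F]_(\rank S, q) := val_submod (U := S) 1%:M *m orbit_mx.

Lemma specht_homJ g : specht F n s g *m specht_hom = specht_hom *m rG g.
Proof.
rewrite /specht_hom -[RHS]mulmxA -orbit_mx_hom [RHS]mulmxA [LHS]mulmxA; congr (_ *m _).
have := val_submodJ (cyclic_mx_module aG (polytabloid F n s)) 1%:M (in_setT g).
by rewrite mul1mx val_submodE.
Qed.

Lemma specht_hom_young g : exists v : 'rV_(\rank S),
  v *m specht_hom = w *m young s rG *m rG g.
Proof.
exists (in_submod S (polytabloid F n s *m aG g)).
rewrite /specht_hom mulmxA -val_submodE in_submodK; last first.
  have /mxmoduleP modS := cyclic_mx_module aG (polytabloid F n s).
  by apply: submx_trans (modS g _); rewrite ?inE // submxMr // cyclic_mx_id.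
by rewrite -[LHS]mulmxA (orbit_mx_hom g) [LHS]mulmxA polytabloid_orbit.
Qed.

End SpechtHom.

(** Reduces an additive property on a part module to translates of symmetrized vectors, which lie in
    images of Specht modules. *)
Lemma part_module_ind (F : fieldType) n m q
    (rG : mx_representation F [set: 'S_n]%G q) k (E : 'M_(k, q))
    (P : pred (seq nat)) (Q : 'rV[F]_q -> Prop) :
  Q 0 -> (forall a b, Q a -> Q b -> Q (a + b)) ->
  (forall s w g, is_part n s -> (size s <= m)%N -> P s ->
     Q (w *m young s rG *m rG g)) ->
  forall v : 'rV_q, (v <= part_module m rG E P)%MS -> Q v.
Proof.
move=> Q0 QD Qs v /sub_sumsmxP[x ->].
apply: big_ind => // t /andP[tP Pt].
have /sub_sumsmxP[y ->] : (x t *m gen_module rG (E *m young (shape_of t) rG) <=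
    gen_module rG (E *m young (shape_of t) rG))%MS by exact: submxMl.
apply: big_ind => // g _.
have /submxP[c ->] : (y g *m <<E *m young (shape_of t) rG *m rG g>> <=
    E *m young (shape_of t) rG *m rG g)%MS by rewrite -(genmxE (E *m _ *m _)) submxMl.
rewrite mulmxA (mulmxA c E); apply: Qs => //.
rewrite size_filter; apply: leq_trans (count_size _ _) _.
by rewrite size_map size_enum_ord.
Qed.

(** * The invariant pairing of words *)

Section Pairing.

Variables (C : numClosedFieldType) (n d e : nat) (u : 'I_e -> 'I_d -> 'I_d -> C).

Local Notation U := (fun i : 'I_#|{: {ffun 'I_n -> 'I_e}}| => word_unitary u (enum_val i)).
Local Notation rX := (word_repr C n d).
Local Notation rF := (word_repr C n e).

Lemma word_mx_entry (A : 'M[C]_#|{: {ffun 'I_n -> 'I_d}}|) g x y :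
  (word_mx C d g *m A *m (word_mx C d g)^T) x y =
  A (enum_rank (wact (enum_val x) g)) (enum_rank (wact (enum_val y) g)).
Proof.
have rowW k (B : 'M[C]_(_, k)) i j : (word_mx C d g *m B) i j =
    B (enum_rank (wact (enum_val i) g)) j.
  have -> : (word_mx C d g *m B) i j = row i (word_mx C d g *m B) 0 j by rewrite [RHS]mxE.
  by rewrite row_mul rowK /word_delta -rowE mxE.
by rewrite -mulmxA rowW -[A *m _]trmxK trmx_mul trmxK mxE rowW mxE.
Qed.

(** Permuting the tensor factors of the matrix is undone by permuting its row and column words
    alike. *)
Lemma word_unitary_invariant (f : {ffun 'I_n -> 'I_e}) g :
  word_mx C d g *m word_unitary u (wact f g) *m (word_mx C d g)^T = word_unitary u f.
Proof.
apply/matrixP => x y; rewrite word_mx_entry !mxE !enum_rankK.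
rewrite (reindex_inj (@perm_inj _ g)) /=; apply: eq_bigr => k _.
by rewrite !ffunE permK.
Qed.

Lemma combine_delta f : combine U (word_delta C f) = word_unitary u f.
Proof.
rewrite /combine (bigD1 (enum_rank f)) //= big1 ?addr0 => [|i ni].
  by rewrite mxE !eqxx scale1r enum_rankK.
by rewrite mxE eqxx (negbTE ni) scale0r.
Qed.

Lemma combine_invariant w g :
  word_mx C d g *m combine U (w *m word_mx C e g) *m (word_mx C d g)^T = combine U w.
Proof.
rewrite mulmx_sum_row [combine _ _]linear_sum mulmx_sumr mulmx_suml [RHS]/combine.
apply: eq_bigr => i _; rewrite linearZ /= -scalemxAr -scalemxAl; congr (_ *: _).
by rewrite rowK combine_delta word_unitary_invariant.
Qed.

Definition pairing (w : 'rV[C]_#|{: {ffun 'I_n -> 'I_e}}|)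
    (x y : 'rV[C]_#|{: {ffun 'I_n -> 'I_d}}|) : C := (x *m combine U w *m y^T) 0 0.

Lemma pairing_invariant w x y g :
  pairing (w *m word_mx C e g) (x *m word_mx C d g) (y *m word_mx C d g) =
  pairing w x y.
Proof.
rewrite /pairing -(combine_invariant w g) trmx_mul !mulmxA.
by [].
Qed.

(** The three vectors lie in images of Specht modules; pulled back along these maps, the pairing is
    an invariant trilinear form. *)
Lemma pairing_young_eq0 s t1 t2 : 
  \rank (rfix_mx (prod_repr (prod_repr (specht C n s) (specht C n t1)) (specht C n t2))
    [set: 'S_n]) = 0%N ->
  forall w x y g g1 g2, pairing (w *m young s rF *m rF g)
    (x *m young t1 rX *m rX g1) (y *m young t2 rX *m rX g2) = 0.
Proof.
move=> r0 w x y g g1 g2.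
have [a <-] := specht_hom_young s rF w g.
have [b <-] := specht_hom_young t1 rX x g1.
have [c <-] := specht_hom_young t2 rX y g2.
set Fs := specht_hom s rF w; set F1 := specht_hom t1 rX x.
set F2 := specht_hom t2 rX y.
pose t i j k := pairing (row i Fs) (row j F1) (row k F2).
have tE a' b' c' : pairing (a' *m Fs) (b' *m F1) (c' *m F2) = trilinear t a' b' c'.
  rewrite /pairing /trilinear (mulmx_sum_row a') (mulmx_sum_row b') (mulmx_sum_row c').
  rewrite [combine _ _]linear_sum /= mulmx_sumr.
  rewrite mulmx_suml summxE; apply: eq_bigr => i _.
  rewrite linearZ /= -scalemxAr -scalemxAl mulmx_suml mulmx_suml scaler_sumr summxE.
  apply: eq_bigr => j _.
  rewrite -!scalemxAl [_^T]linear_sum mulmx_sumr !scaler_sumr summxE; apply: eq_bigr => k _.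
  rewrite /= [_^T]linearZ /= -scalemxAr !scalerA mxE -/(pairing _ _ _) -/(t i j k).
  by ring.
rewrite tE; apply: (trilinear_invariant_eq0 (pchar_num C) _ r0) => h a' b' c' _.
have hJ m (v : 'rV[C]_m) (A : 'M_m) k (B : 'M_(m, k)) (D : 'M_k) :
    A *m B = B *m D -> v *m A *m B = v *m B *m D.
  by move=> AB; rewrite -!mulmxA AB.
rewrite -!tE (hJ _ _ _ _ _ _ (specht_homJ s rF w h)).
rewrite (hJ _ _ _ _ _ _ (specht_homJ t1 rX x h)) (hJ _ _ _ _ _ _ (specht_homJ t2 rX y h)).
by rewrite -[RHS](pairing_invariant _ _ _ h).
Qed.

End Pairing.

Lemma content_proj_mod (F : fieldType) n m b :
  mxmodule (word_repr F n m) (content_proj F b).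
Proof.
by apply/mxmoduleP => g _ /=; rewrite content_projC submxMl.
Qed.

Lemma part_module_sub (F : fieldType) n m q
    (rG : mx_representation F [set: 'S_n]%G q) k (E : 'M_(k, q)) P :
  mxmodule rG E -> (part_module m rG E P <= E)%MS.
Proof.
move=> modE; apply/sumsmx_subP => t _; apply: gen_module_sub => g Gg.
apply: submx_trans (submxMr _ (young_module _ modE)) _.
by move/mxmoduleP: modE; apply.
Qed.

(** [P] and [Q] select the near shapes. If no near triple worked, the pairing would vanish on [W],
    [X], [X], and [rank_annihilated_le] would force [W] to have at most half the dimension of its
    content space. *)
Lemma kronecker_near (C : numClosedFieldType) n d (b : {ffun 'I_(d ^ 2) -> 'I_n.+1})
    (P Q : pred (seq nat)) : (0 < d)%N ->
  (2 * \rank (part_module (d ^ 2) (word_repr C n (d ^ 2)) (content_proj C b) (predC P)) <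
     \rank (content_proj C b))%N ->
  (4 * \rank (part_module d (word_repr C n d) 1%:M (predC Q)) <= d ^ n)%N ->
  (forall s, is_part n s -> (d ^ 2 < size s)%N -> young s (word_repr C n (d ^ 2)) = 0) ->
  (forall s, is_part n s -> (d < size s)%N -> young s (word_repr C n d) = 0) ->
  exists s t1 t2, [/\ is_part n s /\ (size s <= d ^ 2)%N,
    is_part n t1 /\ (size t1 <= d)%N, is_part n t2 /\ (size t2 <= d)%N,
    [/\ P s, Q t1 & Q t2] &
    \rank (rfix_mx (prod_repr (prod_repr (specht C n s) (specht C n t1)) (specht C n t2))
      [set: 'S_n]) <> 0%N].
Proof.
move=> d0 hP hQ yF yX; apply: boolp.contrapT => no.
have [z zP] := prim_root_exists C d0.
pose u := clock_shift z (d := d).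
have uU := @word_unitaryP C n d _ u (clock_shift_unitary d0 zP).
have uO := @word_unitary_orth C n d _ u (clock_shift_orth d0 zP).
pose U (i : 'I_#|{: {ffun 'I_n -> 'I_(d ^ 2)}}|) := word_unitary (n := n) u (enum_val i).
have UU i : U i *m (U i)^t* = 1%:M by exact: uU.
have UO i j : \tr (U i *m (U j)^t*) = #|{: {ffun 'I_n -> 'I_d}}|%:R *+ (i == j).
  by rewrite uO (inj_eq enum_val_inj).
pose W := part_module (d ^ 2) (word_repr C n (d ^ 2)) (content_proj C b) P.
pose X := part_module d (word_repr C n d) 1%:M Q.
have F0 := pchar_num C.
have modE := content_proj_mod C b.
have WS i j : j \notin [set j : 'I_#|{: {ffun 'I_n -> 'I_(d ^ 2)}}| |
    content (enum_val j) == b] -> W i j = 0.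
  rewrite inE => nj; have /submxP[D ->] : (W <= content_proj C b)%MS.
    exact: part_module_sub.
  rewrite /content_proj mul_mx_diag !mxE.
  by rewrite (negbTE nj) mulr0.
have pair0 w x y : (w <= W)%MS -> (x <= X)%MS -> (y <= X)%MS -> pairing u w x y = 0.
  move=> wW xX yX'; move: w wW; apply: part_module_ind => [|w w' h h'|s w g sP sm Ps].
  - by rewrite /pairing linear0 mulmx0 mul0mx mxE.
  - have pD : pairing u (w + w') x y = pairing u w x y + pairing u w' x y.
      by rewrite /pairing linearD mulmxDr mulmxDl [LHS]mxE.
    by rewrite pD h h' addr0.
  move: x xX; apply: part_module_ind => [|x x' h h'|t x g1 tP tm Qt].
  - by rewrite /pairing !mul0mx mxE.
  - have pD v : pairing u v (x + x') y = pairing u v x y + pairing u v x' y.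
      by rewrite /pairing !mulmxDl [LHS]mxE.
    by rewrite pD h h' addr0.
  move: y yX'; apply: part_module_ind => [|y y' h h'|t' y g2 tP' tm' Qt'].
  - by rewrite /pairing trmx0 mulmx0 mxE.
  - have pD v v' : pairing u v v' (y + y') = pairing u v v' y + pairing u v v' y'.
      by rewrite /pairing linearD mulmxDr [LHS]mxE.
    by rewrite pD h h' addr0.
  apply: pairing_young_eq0; apply/eqP; apply: contraT => /eqP nz.
  by case: no; exists s, t, t'; split.
have XWX i : X *m combine U (row i W) *m X^T = 0.
  apply/matrixP => j k; rewrite [RHS]mxE.
  rewrite -(pair0 (row i W) (row j X) (row k X)) ?row_sub //.
  by rewrite /pairing tr_row colE mulmxA -!row_mul -colE [RHS]mxE [RHS]mxE.
have := rank_annihilated_le UU UO WS XWX.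
have WW := part_module_complete (m := d ^ 2) P F0 modE.
have {WW} WW : (\rank (content_proj C b) <= \rank W +
    \rank (part_module (d ^ 2) (word_repr C n (d ^ 2)) (content_proj C b) (predC P)))%N.
  apply: leq_trans (mxrankS (WW _)) (mxrank_adds_leqif _ _) => s sP ms.
  by rewrite yF // mulmx0.
have modX : mxmodule (word_repr C n d) 1%:M by exact: mxmodule1.
have XX := part_module_complete (m := d) Q F0 modX.
have {XX} : (\rank (1%:M : 'M[C]_#|{: {ffun 'I_n -> 'I_d}}|) <=
    \rank X + \rank (part_module d (word_repr C n d) 1%:M (predC Q)))%N.
  apply: leq_trans (mxrankS (XX _)) (mxrank_adds_leqif _ _) => s sP ms.
  by rewrite yX // mulmx0.
rewrite mxrank1.
have -> : #|[set j : 'I_#|{: {ffun 'I_n -> 'I_(d ^ 2)}}| |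
    content (enum_val j) == b]| = \rank (content_proj C b).
  rewrite rank_content_proj; apply: etrans (esym (card_imset _ (@enum_val_inj _ _))) _.
  apply: eq_card => f.
  rewrite inE; apply/imsetP/eqP => [[j]|fb]; first by rewrite inE => /eqP jb ->.
  by exists (enum_rank f); rewrite ?inE ?enum_rankK ?fb.
have eN : #|{: {ffun 'I_n -> 'I_d}}| = (d ^ n)%N by rewrite card_ffun !card_ord.
have : (0 < d ^ n)%N by rewrite expn_gt0 d0.
(* [D] and [N] are the full dimensions, [w] and [x] the near ranks, [bW] and [bX] the far ones: [w]
   exceeds half of [D], while [N - x] is at most a quarter of [N]. *)
have arith (bW bX D w x N : nat) : (2 * bW < D)%N -> (4 * bX <= N)%N ->
    (D <= w + bW)%N -> (0 < N)%N -> (N <= x + bX)%N ->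
    (w * N <= D * (N - x + (N - x)))%N -> False.
  move=> h1 h2 h3 h4 h5 h6.
  have h7 : (D * N < 2 * w * N)%N by rewrite ltn_pmul2r //; lia.
  have h8 : (D * (N - x + (N - x)) * 2 <= D * N)%N.
    by rewrite -mulnA leq_mul2l; apply/orP; right; lia.
  lia.
move=> N0 hX hWX; apply: (arith _ _ _ _ _ _ hP hQ WW N0); rewrite -eN.
  exact: hX.
exact: hWX.
Qed.

(** * Main estimate *)

Lemma sum_nth_part m s : (size s <= m)%N -> (\sum_(i < m) nth 0%N s i)%N = sumn s.
Proof.
move=> sm; rewrite sumnE (big_nth 0%N) big_mkord.
rewrite [RHS](big_ord_widen_cond m xpredT (fun i => nth 0%N s i)) //= [RHS]big_mkcond /=.
by apply: eq_bigr => i _; case: ltnP => // h; rewrite nth_default.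
Qed.

Lemma l1_dist_widen (R : realType) m s t : (size s <= m)%N -> (size t <= m)%N ->
  l1_dist R s t = \sum_(i < m) `|(nth 0%N s i)%:R - (nth 0%N t i)%:R|.
Proof.
move=> sm tm; rewrite /l1_dist.
rewrite [LHS](big_ord_widen_cond m xpredT
  (fun i => `|(nth 0%N s i)%:R - (nth 0%N t i)%:R| : R)) ?geq_max ?sm //=.
rewrite big_mkcond /=; apply: eq_bigr => i _; case: ltnP => //.
rewrite geq_max => /andP[h h']; rewrite !nth_default //.
by rewrite subrr normr0.
Qed.

Lemma nth_scale k s i : nth 0%N (scale_part k s) i = (k * nth 0%N s i)%N.
Proof.
have [h|h] := ltnP i (size s); first by rewrite (nth_map 0%N).
by rewrite !nth_default ?muln0 // size_map.
Qed.

Lemma far_l1_dist (R : realType) n m k (p : nat -> R) (eps : R) s t :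
  (0 < n)%N -> (size s <= m)%N -> (size t <= m)%N ->
  (forall i, (i < m)%N -> (k * nth 0%N t i)%:R = n%:R * p i) ->
  ~~ far n m p eps s ->
  l1_dist R s (scale_part k t) <= eps * n%:R.
Proof.
move=> n0 sm tm tp; rewrite /far -leNgt => h.
rewrite (@l1_dist_widen R m) ?size_map //.
have nR : (0 : R) < n%:R by rewrite ltr0n.
have -> : \sum_(i < m) `|(nth 0%N s i)%:R - (nth 0%N (scale_part k t) i)%:R| =
    (\sum_(i < m) `|p i - (nth 0%N s i)%:R / n%:R|) * n%:R.
  rewrite mulr_suml; apply: eq_bigr => i _.
  rewrite nth_scale tp // -[X in _ = _ * X]ger0_norm ?ler0n // -normrM distrC.
  by rewrite mulrBl divfK ?gt_eqF // mulrC.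
by rewrite ler_wpM2r // ltW.
Qed.

(** As [24 / 4 = 6], the exponential is at most the inverse of [n.+1 ^ (6 * d ^ 4)]. After
    cancelling the power [a], at least three factors, each at least 2, remain. *)
Lemma pow_expR_small (R : realType) (n d a : nat) (x : R) :
  (0 < n)%N -> (0 < d)%N -> (a <= 3 * d ^ 4)%N ->
  24 * d%:R ^+ 4 * ln n.+1%:R <= x ->
  n.+1%:R ^+ a * expR (- (x / 4)) <= 1 / 8.
Proof.
move=> n0 d0 ad hx; have n1 : (1 : R) <= n.+1%:R by rewrite ler1n.
have n2 : (2 : R) <= n.+1%:R by rewrite ler_nat.
have npos : (0 : R) < n.+1%:R by rewrite ltr0n.
have e1 : expR (- (x / 4)) <= (n.+1%:R ^+ (6 * d ^ 4))^-1.
  rewrite -{1}[n.+1%:R](@lnK R) ?posrE // -expRM_natl -expRN ler_expR.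
  by rewrite lerN2 natrM natrX; lra.
apply: le_trans (ler_wpM2l _ e1) _; first by rewrite exprn_ge0 // ltW.
rewrite ler_pdivrMr ?exprn_gt0 //.
have -> : (6 * d ^ 4 = a + (6 * d ^ 4 - a))%N by lia.
rewrite exprD mulrCA; apply: ler_peMr; first by rewrite exprn_ge0 // ltW.
have d4 : (0 < d ^ 4)%N by rewrite expn_gt0 d0.
have h3 : (3 <= 6 * d ^ 4 - a)%N by lia.
have h8 : (2 : R) ^+ 3 <= n.+1%:R ^+ 3.
  by rewrite lerXn2r ?nnegrE // ltW.
have := ler_weXn2l n1 h3; lra.
Qed.

Lemma near_triple (R : realType) (d l k : nat) (lambda : seq nat) (eps : R) :
  (0 < d)%N -> (0 < l)%N -> (0 < k)%N -> partition_of (d ^ 2) (l * d) lambda ->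
  0 <= eps ->
  24 * d%:R ^+ 4 * ln (k * l * d).+1%:R <= (k * l * d)%:R * eps ^+ 2 ->
  exists Lambda R1 R2 : seq nat,
    [/\ partition_of (d ^ 2) (k * l * d) Lambda,
      partition_of d (k * l * d) R1 /\ partition_of d (k * l * d) R2,
      kronecker R (k * l * d) Lambda R1 R2 <> 0%N,
      l1_dist R Lambda (scale_part k lambda) <= eps * (k * l * d)%:R &
      l1_dist R R1 (scale_part k (rect_part d l)) <= eps * (k * l * d)%:R /\
      l1_dist R R2 (scale_part k (rect_part d l)) <= eps * (k * l * d)%:R].
Proof.
move=> d0 l0 k0 /and4P[lam_s lam_0 lam_d /eqP lam_n] e0; set n := (k * l * d)%N => hn.
have n0 : (0 < n)%N by rewrite !muln_gt0 k0 l0 d0.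
have ldR : (0 : R) < (l * d)%:R by rewrite ltr0n muln_gt0 l0 d0.
have d20 : (0 < d ^ 2)%N by rewrite expn_gt0 d0.
pose p i : R := (nth 0%N lambda i)%:R / (l * d)%:R.
have p0 i : 0 <= p i by rewrite divr_ge0.
have pd : {homo p : i j / (i <= j)%N >-> j <= i}.
  move=> i j ij; rewrite ler_wpM2r ?invr_ge0 ?ler0n // ler_nat.
  exact: nth_part_homo.
have p1 : \sum_(i < d ^ 2) p i = 1.
  by rewrite -mulr_suml -natr_sum sum_nth_part // lam_n divff // gt_eqF.
have F0 := pchar_num R[i].
have small a : (a <= 3 * d ^ 4)%N ->
    (n.+1%:R : R) ^+ a * expR (- (n%:R * eps ^+ 2 / 4)) <= 1 / 8.
  by move=> ad; apply: pow_expR_small hn.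
have dd : (d <= d ^ 2)%N by rewrite -{1}[d]expn1 leq_pexp2l.
have dd4 : (d ^ 2 <= d ^ 4)%N by rewrite leq_pexp2l.
have [|b hb] := far_content F0 n0 p0 p1 pd e0.
  apply: le_lt_trans (_ : 1 / 8 < _); last by lra.
  (* The exponents add up to [d ^ 2 + d ^ 2 + d ^ 4], at most [3 * d ^ 4]. *)
  move: (expR _) small => B small; rewrite !mulrA -!natrM -!expnD natrX; apply: small.
  by rewrite -[(2 + 2)%N]/4%N; lia.
have hX : (4 * \rank (part_module d (word_repr R[i] n d) 1%:M
     (far n d (fun=> d%:R^-1) eps)) <= d ^ n)%N.
  apply: far_uniform => //; apply: le_trans (_ : 1 / 8 <= _); last by lra.
  move: (expR _) small => B small; rewrite !mulrA -!natrM -!expnD natrX.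
  by apply: small; rewrite mulnn; lia.
pose P s := ~~ far n (d ^ 2) p eps s.
pose Q s := ~~ far n d (fun=> d%:R^-1 : R) eps s.
have PC E : part_module (d ^ 2) (word_repr R[i] n (d ^ 2)) E (predC P) =
    part_module (d ^ 2) (word_repr R[i] n (d ^ 2)) E (far n (d ^ 2) p eps).
  by apply: eq_bigl => t; rewrite /= negbK.
have QC E : part_module d (word_repr R[i] n d) E (predC Q) =
    part_module d (word_repr R[i] n d) E (far n d (fun=> d%:R^-1) eps).
  by apply: eq_bigl => t; rewrite /= negbK.
have yF s : is_part n s -> (d ^ 2 < size s)%N -> young s (word_repr R[i] n (d ^ 2)) = 0.
  by move=> sP ms; rewrite -[LHS]mul1mx (young_word_size F0 p0 pd sP ms).
have yX s : is_part n s -> (d < size s)%N -> young s (word_repr R[i] n d) = 0.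
  have q0 (i : nat) : (0 : R) <= d%:R^-1 by rewrite invr_ge0 ler0n.
  have qd : {homo (fun=> d%:R^-1 : R) : i j / (i <= j)%N >-> j <= i} by [].
  by move=> sP ms; rewrite -[LHS]mul1mx (young_word_size F0 q0 qd sP ms).
rewrite -PC in hb; rewrite -QC in hX.
have [s [t1 [t2 [[sP sd] [tP td] [tP' td'] [Ps Qt Qt'] nz]]]] :=
  kronecker_near d0 hb hX yF yX.
have part_of m u : is_part n u -> (size u <= m)%N -> partition_of m n u.
  by move=> /and3P[us u0 un] um; rewrite /partition_of us u0 um un.
exists s, t1, t2; split.
- exact: part_of.
- by split; apply: part_of.
- exact: nz.
- apply: (far_l1_dist (p := p)) Ps => // i _.
  rewrite /p /n -mulnA [(k * _)%:R]natrM [(k * (l * d))%:R]natrM -!mulrA.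
  by rewrite (mulrC (l * d)%:R) divfK ?gt_eqF.
have rect i : (i < d)%N -> (k * nth 0%N (rect_part d l) i)%:R = n%:R * (d%:R^-1 : R).
  by move=> id; rewrite nth_nseq id /n [in RHS]natrM mulfK // pnatr_eq0 -lt0n.
split; [apply: far_l1_dist rect Qt | apply: far_l1_dist rect Qt'] => //;
  by rewrite size_nseq.
Qed.

(** * Logarithmic estimates and the choice of [k] *)

Lemma ln_le_self (R : realType) (x : R) : 0 < x -> ln x <= x.
Proof.
move=> x0; have /le_ln1Dx : -1 < x - 1 by lra.
by rewrite addrC subrK => h; lra.
Qed.

(** From [expR (- (1 / 2)) >= 1 / 2] follows [expR (1 / 2) <= 2]. *)
Lemma ln2_ge (R : realType) : 1 / 2 <= ln (2 : R).
Proof.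
rewrite -ler_expR lnK ?posrE //.
have := expR_ge1Dx (- (1 / 2) : R); rewrite expRN => h.
have e0 := expR_gt0 (1 / 2 : R).
have : (1 / 2 : R) * expR (1 / 2) <= 1.
  by rewrite -ler_pdivlMr // [1 / expR _]div1r; lra.
lra.
Qed.

(** Splitting the logarithm and using [ln x <= x] and [ln X >= 1 / 2] bounds it by
    [35 * (l * d * ln X)], and [24 * 35 <= 1024]. The factor [l] on the right absorbs [ln l], so the
    choice of [k] can be independent of [l]. *)
Lemma ln_size_le (R : realType) (d l k X : R) :
  1 <= d -> 1 <= l -> 1 <= k -> 2 <= X -> k <= 2 ^+ 11 * d ^+ 2 * X ^+ 2 * ln X ->
  24 * ln (k * l * d + 1) <= 1024 * (l * d * ln X).
Proof.
move=> d1 l1 k1 X2 kK; set L := ln X in kK *.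
have d0 : 0 < d by lra.
have l0 : 0 < l by lra.
have X0 : 0 < X by lra.
have k0 : 0 < k by lra.
have hl2 := ln2_ge R; have l2le : ln (2 : R) <= 1.
  by have /le_ln1Dx : -1 < (1 : R) by lra.
have L2 : 1 / 2 <= L by apply: le_trans hl2 _; rewrite ler_ln ?posrE.
have L0 : 0 < L by lra.
have kld : 1 <= k * l * d by rewrite !mulr_ege1.
have s1 : ln (k * l * d + 1) <= ln 2 + ln k + ln l + ln d.
  rewrite -!lnM ?posrE ?mulr_gt0 // ler_ln ?posrE ?mulr_gt0 //; clear -kld; lra.
have s2 : ln k <= 11 * ln 2 + 2 * ln d + 2 * L + ln L.
  have -> : 11 * ln 2 + 2 * ln d + 2 * L + ln L = ln (2 ^+ 11 * d ^+ 2 * X ^+ 2 * L).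
    have lnMM (a b : R) : 0 < a -> 0 < b -> ln (a * b) = ln a + ln b.
      by move=> a0 b0; rewrite lnM ?posrE.
    rewrite (lnMM (2 ^+ 11 * d ^+ 2 * X ^+ 2) L) ?mulr_gt0 ?exprn_gt0 //.
    rewrite (lnMM (2 ^+ 11 * d ^+ 2)) ?mulr_gt0 ?exprn_gt0 //.
    rewrite (lnMM (2 ^+ 11)) ?exprn_gt0 // !lnXn //.
    by rewrite /L; ring.
  by rewrite ler_ln ?posrE // ?mulr_gt0 ?exprn_gt0.
have ld := ln_le_self d0; have ll := ln_le_self l0; have lL := ln_le_self L0.
have ldL : 1 <= l * d by rewrite mulr_ege1.
have h1 : L <= l * d * L by rewrite ler_peMl // ltW.
have L1 : 1 <= 2 * L by lra.
have h2 : d <= d * (l * (2 * L)) by apply: ler_peMr (ltW d0) (mulr_ege1 l1 L1).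
have h3 : l <= l * (d * (2 * L)) by apply: ler_peMr (ltW l0) (mulr_ege1 d1 L1).
have P1 : d * (l * (2 * L)) = 2 * (l * d * L) by ring.
have P2 : l * (d * (2 * L)) = 2 * (l * d * L) by ring.
rewrite P1 in h2; rewrite P2 in h3.
move: h1 h2 h3 s1 s2 ld ll lL l2le L1 hl2; clear.
move: (l * d * L) (ln (k * l * d + 1)) (ln k) (ln l) (ln d) (ln L) (ln 2).
move=> P a1 a2 a3 a4 a5 a6 *; lra.
Qed.

Theorem theorem2 (R : realType) :
  exists C : R, 0 < C /\
  forall (d l : nat) (lambda : seq nat) (eps : R),
    (1 <= d)%N -> (1 <= l)%N -> partition_of (d ^ 2) (l * d) lambda ->
    0 < eps ->
    exists (k : nat) (Lambda R1 R2 : seq nat),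
      (1 <= k)%N /\
      partition_of (d ^ 2) (k * l * d) Lambda /\
      partition_of d (k * l * d) R1 /\
      partition_of d (k * l * d) R2 /\
      kronecker R (k * l * d) Lambda R1 R2 <> 0%N /\
      l1_dist R Lambda (scale_part k lambda) <= eps * (sumn Lambda)%:R /\
      l1_dist R R1 (scale_part k (rect_part d l)) <= eps * (sumn R1)%:R /\
      l1_dist R R2 (scale_part k (rect_part d l)) <= eps * (sumn R2)%:R /\
      (2 <= d%:R / eps ->
       k%:R <= C * (d%:R ^+ 4 / eps ^+ 2) * ln (d%:R / eps)).
Proof.
exists (2 ^+ 11); split; first by rewrite exprn_gt0.
move=> d l lambda eps d0 l0 lamP eps0.
have d1 : (1 : R) <= d%:R by rewrite ler1n.
have l1 : (1 : R) <= l%:R by rewrite ler1n.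
have dR : (0 : R) < d%:R by rewrite ltr0n.
(* Lowering [eps] to at most [d / 2] ensures [X >= 2], which keeps [ln X] away from 0 also for large
   [eps]. *)
pose eps' := Num.min eps (d%:R / 2).
have eps'0 : 0 < eps' by rewrite lt_min eps0 divr_gt0.
have eps'_le : eps' <= eps by rewrite ge_min lexx.
set X := d%:R / eps'; have X2 : 2 <= X.
  by rewrite ler_pdivlMr // mulrC -ler_pdivlMr // ge_min lexx orbT.
have X0 : 0 < X by rewrite divr_gt0.
have eX : eps' = d%:R / X by rewrite /X invf_div mulrC divfK // gt_eqF.
pose L := ln X.
have L2 : 1 / 2 <= L.
  by apply: le_trans (ln2_ge R) _; rewrite ler_ln ?posrE.
have L0 : 0 < L by apply: lt_le_trans L2; rewrite divr_gt0.
(* Since [X = d / eps'], this is [2 ^+ 10 * d ^+ 4 / eps' ^+ 2 * ln X]. As [K >= 1], rounding up at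
   most doubles it, whence the constant [2 ^+ 11]. *)
pose K := 2 ^+ 10 * d%:R ^+ 2 * X ^+ 2 * L.
have K1 : 1 <= K.
  have hXL : 1 <= X ^+ 2 * L.
    have : 2 * (1 / 2) <= X ^+ 2 * L.
      apply: ler_pM; [by [] | by rewrite divr_ge0 | apply: (le_trans X2) | exact: L2].
      by rewrite expr2; apply: ler_peMr; [exact: ltW | lra].
    by rewrite mulrCA mulfV ?mulr1 // pnatr_eq0.
  rewrite /K -mulrA; apply: (mulr_ege1 _ hXL).
  by apply: mulr_ege1; apply: exprn_ege1; rewrite ?ler1n.
pose k := (Num.truncn K).+1.
have Kk : K <= k%:R by rewrite ltW // truncnS_gt.
have kK : k%:R <= 2 ^+ 11 * d%:R ^+ 2 * X ^+ 2 * L.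
  have -> : 2 ^+ 11 * d%:R ^+ 2 * X ^+ 2 * L = K + K by rewrite /K exprS; ring.
  by rewrite /k -addn1 natrD lerD // truncn_le (le_trans _ K1).
have k1 : (1 : R) <= k%:R by rewrite ler1n.
have hn : 24 * d%:R ^+ 4 * ln (k * l * d).+1%:R <= (k * l * d)%:R * eps' ^+ 2.
  rewrite -[(k * l * d).+1]addn1 [(_ + 1)%:R]natrD ![(_ * _)%:R]natrM.
  have h := ln_size_le d1 l1 k1 X2 kK.
  apply: (@le_trans _ _ (d%:R ^+ 4 * (2 ^+ 10 * (l%:R * d%:R * L)))).
    have dR4 : 0 <= (d%:R : R) ^+ 4 by rewrite exprn_ge0.
    rewrite -/L in h; have h' := ler_wpM2l dR4 h.
    have -> : (2 : R) ^+ 10 = 1024 by rewrite -natrX.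
    by rewrite (mulrC 24) -(mulrA (d%:R ^+ 4)).
  have -> : d%:R ^+ 4 * (2 ^+ 10 * (l%:R * d%:R * L)) =
      K * l%:R * d%:R * (d%:R / X) ^+ 2.
    by rewrite /K; field; rewrite gt_eqF.
  by rewrite eX !ler_pM2r ?exprn_gt0 ?divr_gt0 // ltr0n.
have [Lambda [R1 [R2 [LP [P1 P2] nz hL [h1 h2]]]]] :=
  near_triple d0 l0 (ltn0Sn _ : 0 < k)%N lamP (ltW eps'0) hn.
have sum_part m s : partition_of m (k * l * d) s -> sumn s = (k * l * d)%N.
  by case/and4P => _ _ _ /eqP.
have weaken x s m : partition_of m (k * l * d) s ->
    x <= eps' * (k * l * d)%:R -> x <= eps * (sumn s)%:R.
  by move=> /sum_part -> /le_trans; apply; rewrite ler_wpM2r ?ler0n.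
exists k, Lambda, R1, R2; split=> //; do 4! split => //.
split; first exact: weaken LP hL.
split; first exact: weaken P1 h1.
split; first exact: weaken P2 h2.
(* In the range of the quantitative bound the minimum is [eps] itself. *)
move=> hX; have ee : eps' = eps.
  by apply/min_idPl; rewrite ler_pdivlMr // mulrC -ler_pdivlMr.
have -> : d%:R ^+ 4 / eps ^+ 2 = d%:R ^+ 2 * X ^+ 2.
  by rewrite /X ee; field; rewrite gt_eqF.
by rewrite mulrA; apply: le_trans kK _; rewrite /L /X ee.
Qed.
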